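(* Let $M^n$ be a smooth $n$-dimensional manifold. (a) Every conformally flat immersion $f:M^n\to S^{2n-2}$ with flat normal bundle has a flat lift $F:M^n\to\mathcal{L}^{2n-1,1}$ with flat normal bundle. (b) Conversely, any immersion $F:M^n\to\mathcal{L}^{2n-1,1}$ whose induced metric $|dF|^2$ is flat and of definite signature, and whose normal bundle is flat, is a flat lift of a conformally flat immersion $f:M^n\to S^{2n-2}$ with flat normal bundle.
   Context: $\mathbb{R}^{2n-1,1}$ is $\mathbb{R}^{2n}$ with the Lorentzian bilinear form $(x,y)=x^T\operatorname{diag}(1,\dots,1,-1)\,y$, and $\mathcal{L}^{2n-1,1}=\{x\in\mathbb{R}^{2n-1,1}:(x,x)=0\}$ is its light-cone. Fix a vector $t_0$ with $(t_0,t_0)=-1$; then $t_0^\perp$ is a Euclidean space $\mathbb{R}^{2n-1}$ and $S^{2n-2}$ denotes its unit sphere. An immersion $f:M^n\to S^{2n-2}$ with induced metric $\mathrm{I}_f$ is conformally flat if there is a smooth function $u:M\to\mathbb{R}$ such that $e^{2u}\mathrm{I}_f$ is flat. A lift of $f:M\to S^{2n-2}\subset t_0^\perp$ is a map $F:M\to\mathcal{L}^{2n-1,1}$ such that at each point $f+t_0$ lies in the line spanned by $F$. A flat lift is a lift whose induced metric $|dF|^2=(dF,dF)$ is flat. The normal bundle of $f$ is taken in $TS^{2n-2}$; the normal bundle of $F$ is the orthogonal complement of the tangent bundle $\langle dF\rangle$ in the trivial bundle $M\times\mathbb{R}^{2n-1,1}$. A normal bundle is flat if its induced normal connection is flat.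 *)

(* Defs.v *)
From HB Require Import structures.
From mathcomp Require Import all_boot all_order all_algebra.
From mathcomp Require Import all_classical all_reals all_analysis.

Set Implicit Arguments.
Unset Strict Implicit.
Unset Printing Implicit Defensive.

Import Order.TTheory GRing.Theory Num.Theory.
Import numFieldNormedType.Exports.

Local Open Scope classical_set_scope.
Local Open Scope ring_scope.

Section Smoothness.
Context (R : realType) (V W : normedModType R).

(* Meant for V finite-dimensional and U open, where f is C^(k+1) on U iff it is
   differentiable on U and all its directional derivatives are C^k on U. *)
Fixpoint Ck_on (k : nat) (U : set V) (f : V -> W) : Prop :=
  if k is k'.+1 then
    (forall x, U x -> differentiable f x) /\ (forall v, Ck_on k' U ('D_v f))
  else forall x, U x -> {for x, continuous f}.

Definition smooth_on (U : set V) (f : V -> W) : Prop :=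
  forall k, Ck_on k U f.

End Smoothness.

Section Manifolds.
Context (R : realType) (n : nat).

(* The inverse of a chart is a total function; its values outside the image of
   the chart are irrelevant. *)
Record chart (M : topologicalType) := Chart {
  chart_dom : set M;
  chart_map : M -> 'rV[R]_n;
  chart_inv : 'rV[R]_n -> M;
  chart_dom_open : open chart_dom;
  chart_img_open : open (chart_map @` chart_dom);
  chart_mapK : forall p, chart_dom p -> chart_inv (chart_map p) = p;
  chart_map_continuous :
    forall p, chart_dom p -> {for p, continuous chart_map};
  chart_inv_continuous :
    forall x, (chart_map @` chart_dom) x -> {for x, continuous chart_inv} }.

Definition chart_img (M : topologicalType) (c : chart M) : set 'rV[R]_n :=
  chart_map c @` chart_dom c.

Record smoothManifold := SmoothManifold {
  manifold_space :> topologicalType;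
  manifold_hausdorff : hausdorff_space manifold_space;
  manifold_second_countable : @second_countable manifold_space;
  manifold_atlas : set (chart manifold_space);
  manifold_cover :
    forall p, exists2 c, manifold_atlas c & chart_dom c p;
  manifold_transition : forall c d, manifold_atlas c -> manifold_atlas d ->
    smooth_on (chart_map c @` (chart_dom c `&` chart_dom d))
              (chart_map d \o chart_inv c) }.

Definition smooth_map (M : smoothManifold) (W : normedModType R)
    (f : M -> W) : Prop :=
  forall c, manifold_atlas c -> smooth_on (chart_img c) (f \o chart_inv c).

Definition immersion (M : smoothManifold) (W : normedModType R)
    (f : M -> W) : Prop :=
  smooth_map f /\
  forall c, manifold_atlas c -> forall x, chart_img c x ->
    injective ('d (f \o chart_inv c) x).

End Manifolds.

Section Curvature.
Context (R : realType) (n : nat).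

Definition partial (W : normedModType R) (i : 'I_n) (f : 'rV[R]_n -> W) :
  'rV[R]_n -> W := 'D_(delta_mx 0 i) f.

(* Gamma^k_ij *)
Definition christoffel (g : 'rV[R]_n -> 'M[R]_n) (k i j : 'I_n)
    (x : 'rV[R]_n) : R :=
  2^-1 * \sum_l invmx (g x) k l *
    (partial i (fun y => g y j l) x + partial j (fun y => g y i l) x
     - partial l (fun y => g y i j) x).

(* The l-th component of R(d_i, d_j) d_k for the Levi-Civita connection. *)
Definition riemann (g : 'rV[R]_n -> 'M[R]_n) (l k i j : 'I_n)
    (x : 'rV[R]_n) : R :=
  partial i (christoffel g l j k) x - partial j (christoffel g l i k) x
  + \sum_m (christoffel g l i m x * christoffel g m j k x
            - christoffel g l j m x * christoffel g m i k x).

(* A symmetric bilinear form field on M, given by its coordinate expressions: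
   g c x is its Gram matrix at chart_inv c x in the coordinate frame of c. *)
Definition tensor_field (M : smoothManifold R n) :=
  chart R n M -> 'rV[R]_n -> 'M[R]_n.

Definition flat_metric (M : smoothManifold R n) (g : tensor_field M) : Prop :=
  forall c, manifold_atlas c -> forall x, chart_img c x ->
    g c x \in unitmx /\ forall l k i j, riemann (g c) l k i j x = 0.

Definition definite_metric (M : smoothManifold R n) (g : tensor_field M) :
    Prop :=
  forall c, manifold_atlas c -> forall x, chart_img c x ->
    (forall v : 'rV[R]_n, v != 0 -> 0 < (v *m g c x *m v^T) 0 0) \/
    (forall v : 'rV[R]_n, v != 0 -> (v *m g c x *m v^T) 0 0 < 0).

End Curvature.

Section Lorentz.
Context (R : realType) (n : nat).

Definition lorentz_mx : 'M[R]_(2 * n) :=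
  diag_mx (\row_(i < 2 * n) if i.+1 == (2 * n)%N then -1 else 1).

Definition lorentz (x y : 'rV[R]_(2 * n)) : R :=
  (x *m lorentz_mx *m y^T) 0 0.

Definition light_cone : set 'rV[R]_(2 * n) := [set x | lorentz x x = 0].

Definition unit_sphere (t0 : 'rV[R]_(2 * n)) : set 'rV[R]_(2 * n) :=
  [set x | lorentz x t0 = 0 /\ lorentz x x = 1].

Definition gram k (B : 'M[R]_(k, 2 * n)) : 'M[R]_k :=
  B *m lorentz_mx *m B^T.

(* The orthogonal projection onto the orthogonal complement of the rows of B,
   when these rows are linearly independent and span a nondegenerate space. *)
Definition normal_proj k (B : 'M[R]_(k, 2 * n)) (v : 'rV[R]_(2 * n)) :
    'rV[R]_(2 * n) :=
  v - v *m lorentz_mx *m B^T *m invmx (gram B) *m B.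

Definition normal_section k (U : set 'rV[R]_n)
    (B : 'rV[R]_n -> 'M[R]_(k, 2 * n)) (xi : 'rV[R]_n -> 'rV[R]_(2 * n)) :
    Prop :=
  smooth_on U xi /\ forall x, U x -> B x *m lorentz_mx *m (xi x)^T = 0.

Definition normal_connection k (B : 'rV[R]_n -> 'M[R]_(k, 2 * n)) (i : 'I_n)
    (xi : 'rV[R]_n -> 'rV[R]_(2 * n)) (x : 'rV[R]_n) : 'rV[R]_(2 * n) :=
  normal_proj (B x) (partial i xi x).

Definition normal_curvature k (B : 'rV[R]_n -> 'M[R]_(k, 2 * n)) (i j : 'I_n)
    (xi : 'rV[R]_n -> 'rV[R]_(2 * n)) (x : 'rV[R]_n) : 'rV[R]_(2 * n) :=
  normal_connection B i (normal_connection B j xi) x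
  - normal_connection B j (normal_connection B i xi) x.

(* The bundle orthogonal to the rows of B is flat. The curvature is tensorial
   and coordinate fields commute, so the fields d_i, d_j suffice. *)
Definition flat_complement (M : smoothManifold R n) k
    (B : chart R n M -> 'rV[R]_n -> 'M[R]_(k, 2 * n)) : Prop :=
  forall c, manifold_atlas c ->
  forall U : set 'rV[R]_n, open U -> U `<=` chart_img c ->
  forall xi, normal_section U (B c) xi ->
  forall i j x, U x -> normal_curvature (B c) i j xi x = 0.

Section Maps.
Context (M : smoothManifold R n).
Implicit Types f F : M -> 'rV[R]_(2 * n).

Definition tangent_frame F (c : chart R n M) (x : 'rV[R]_n) :
  'M[R]_(n, 2 * n) := 'J (F \o chart_inv c) x.

Definition induced_metric F : tensor_field M :=
  fun c x => gram (tangent_frame F c x).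

(* For f with values in unit_sphere t0, the normal space of the sphere at f p
   is spanned by f p and t0. *)
Definition sphere_frame (t0 : 'rV[R]_(2 * n)) f (c : chart R n M)
    (x : 'rV[R]_n) : 'M[R]_(n + (1 + 1), 2 * n) :=
  col_mx (tangent_frame f c x) (col_mx (f (chart_inv c x)) t0).

Definition flat_sphere_normal_bundle (t0 : 'rV[R]_(2 * n)) f : Prop :=
  flat_complement (sphere_frame t0 f).

Definition flat_normal_bundle F : Prop := flat_complement (tangent_frame F).

Definition sphere_immersion (t0 : 'rV[R]_(2 * n)) f : Prop :=
  (forall p, unit_sphere t0 (f p)) /\ immersion f.

Definition light_cone_immersion F : Prop :=
  (forall p, light_cone (F p)) /\ immersion F.

Definition conformally_flat f : Prop :=
  exists2 u : M -> R, smooth_map u &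
    flat_metric (fun c x =>
      expR (2 * u (chart_inv c x)) *: induced_metric f c x).

Definition lift (t0 : 'rV[R]_(2 * n)) f F : Prop :=
  [/\ smooth_map F, (forall p, light_cone (F p)) &
      forall p, exists a : R, f p + t0 = a *: F p].

Definition flat_lift (t0 : 'rV[R]_(2 * n)) f F : Prop :=
  lift t0 f F /\ flat_metric (induced_metric F).

End Maps.

End Lorentz.

(* Main.v *)
Require Import Defs.
From HB Require Import structures.
From mathcomp Require Import all_boot all_order all_algebra.
From mathcomp Require Import all_classical all_reals all_analysis.
From mathcomp Require Import ring lra zify.

(** Both constructions compare a map f into the unit sphere of t0^perp with
    the map F = lam (f + t0) into the light-cone, where lam is a nowhere
    vanishing function. From f one obtains F by taking lam = e^u, and from F
    one obtains f by taking lam = -(F,t0) and f = F / lam - t0. As f + t0 is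
    null and orthogonal to df, the induced metrics satisfy |dF|^2 = lam^2
    |df|^2, so the metric of F is flat exactly when a function u with e^(2u) =
    lam^2 exhibits f as conformally flat. When F is given, lam does not
    vanish: F is nowhere zero, because differentiating (F,F) = 0 twice gives
    (F,d_i d_j F) = - (d_i F,d_j F), whose right-hand side is nondegenerate,
    and a nonzero null vector is never orthogonal to the timelike vector t0.

    It remains to compare the normal bundles, which can be done at each point
    of each chart. By the Ricci equation a normal bundle is flat if and only
    if the shape operators of any two normal vectors commute. For a vector
    that is normal to f in the sphere, hence also normal to F, the second
    fundamental forms of f and F differ by the factor lam, so the commutation
    condition for such vectors is the same for f and for F. Therefore the
    normal bundle of f is flat as soon as the one of F is.

    Conversely, the normal space of F is spanned by the normal space of f in
    the sphere, by F, and by one null vector Z orthogonal to the former with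
    (F,Z) = 1. The shape operator of F is -1, hence central, and what is left
    is to see that the shape operator A_Z commutes with those of the normal
    vectors of f. This is where the flatness of |dF|^2 is needed: in the trace
    of the Gauss equation, (n - 2) A_Z is a combination of the identity, of
    shape operators of normal vectors of f, and of sums of products of these
    ([hcommute_gauss_trace]). For n <= 2 the normal space of f in the sphere
    is zero.

    The lemmas that carry the argument are the Ricci equation
    [flat_complement_chartP], the Gauss equation [gauss_equation], the
    algebraic statement [second_form_hcommute], and their combinations
    [lift_normal_flat] and [sphere_normal_flat]. The calculus that they rest
    on consists of the stability of smoothness under algebraic operations and
    of the symmetry of second derivatives [derive_comm]. *)

Set Implicit Arguments.
Unset Strict Implicit.
Unset Printing Implicit Defensive.

Import Order.TTheory GRing.Theory Num.Theory.
Import numFieldNormedType.Exports.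

Local Open Scope classical_set_scope.
Local Open Scope ring_scope.

(** * Calculus of smooth maps *)

Section CkClosure.
Context (R : realType) (V : normedModType R).
Implicit Types (U : set V) (W : normedModType R).

Lemma near_eq_differentiable W (f g : V -> W) (x : V) :
  (\near x, f x = g x) -> differentiable f x -> differentiable g x.
Proof.
move=> fg df.
pose z : V -> W := g - f.
have z0 : \near x, z x = 0.
  by apply: filterS fg => y fgy; rewrite /z !fctE fgy subrr.
suff dz : differentiable z x.
  have -> : g = z + f by rewrite /z subrK.
  exact: differentiableD.
have zx0 : z x = 0 by exact: nbhs_singleton z0.
have c0 : continuous (\0 : {linear V -> W}) by exact: cst_continuous.
have zo : z \o shift x = cst (z x) + (\0 : {linear V -> W}) +o_ 0 id.
  apply/eqaddoP => e e0; near=> h.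
  rewrite !fctE /= zx0 addr0 subr0.
  suff -> : z (h + x) = 0 by rewrite normr0 mulr_ge0// ltW.
  near: h; move: z0; rewrite (near_shift 0 x).
  by apply: filterS => h /=; rewrite subr0.
apply/diff_locallyP; rewrite (diff_unique c0 zo); split => //.
Unshelve. all: by end_near. Qed.

(** A property of all points of an open set holds near each of its points. *)
Lemma near_open U (P : V -> Prop) x :
  open U -> U x -> (forall y, U y -> P y) -> \near x, P x.
Proof. by move=> Uo Ux UP; apply: filterS UP _; exact: open_nbhs_nbhs. Qed.

Lemma derive_congr U W (f g : V -> W) x v : open U -> U x ->
  (forall y, U y -> f y = g y) -> 'D_v f x = 'D_v g x.
Proof. by move=> Uo Ux fg; apply/near_eq_derive/(near_open Uo Ux). Qed.

Lemma Ck_on_congr k U W (f g : V -> W) : open U ->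
  (forall x, U x -> f x = g x) -> Ck_on k U f -> Ck_on k U g.
Proof.
move=> Uo; elim: k f g => [|k IH] f g fg /=.
  move=> cf x Ux; rewrite /prop_for /continuous_at -fg//.
  apply: cvg_trans (cf _ Ux); apply: near_eq_cvg.
  exact: (near_open Uo Ux).
case=> df Df; split=> [x Ux|v].
- by apply: near_eq_differentiable (df _ Ux); exact: (near_open Uo Ux).
- by apply: IH (Df v) => x Ux; exact: derive_congr Uo Ux fg.
Qed.

Lemma Ck_on_sub k U U' W (f : V -> W) : U' `<=` U ->
  Ck_on k U f -> Ck_on k U' f.
Proof.
move=> sU; elim: k f => [|k IH] f /=; first by move=> + x /sU; exact.
by case=> df Df; split=> [x /sU/df|v]//; exact: IH (Df v).
Qed.

(** A C^(k+1) map is C^k. *)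
Lemma Ck_onW k U W (f : V -> W) : Ck_on k.+1 U f -> Ck_on k U f.
Proof.
elim: k f => [|k IH] f [df Df].
  by move=> x Ux; exact/differentiable_continuous/df.
by split=> // v; exact/IH/Df.
Qed.

Lemma Ck_on_cst k U W (w : W) : Ck_on k U (cst w : V -> W).
Proof.
elim: k w => [|k IH] w; first by move=> x _; exact: cvg_cst.
split=> [x _|v]; first exact: differentiable_cst.
by rewrite (_ : 'D_v _ = cst 0)//; apply/funext => x; exact: derive_cst.
Qed.

Lemma Ck_onD k U W (f g : V -> W) : open U ->
  Ck_on k U f -> Ck_on k U g -> Ck_on k U (f + g).
Proof.
move=> Uo; elim: k f g => [|k IH] f g.
  by move=> cf cg x Ux; apply: continuousD; [exact: cf|exact: cg].
move=> [df Df] [dg Dg]; split=> [x Ux|v].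
  by apply: differentiableD; [exact: df|exact: dg].
apply: Ck_on_congr (IH _ _ (Df v) (Dg v)) => // x Ux.
by rewrite deriveD//; apply: diff_derivable; [exact: df|exact: dg].
Qed.

Lemma Ck_onM k U (f g : V -> R) : open U ->
  Ck_on k U f -> Ck_on k U g -> Ck_on k U (f * g).
Proof.
move=> Uo; elim: k f g => [|k IH] f g.
  by move=> cf cg x Ux; apply: continuousM; [exact: cf|exact: cg].
move=> Cf Cg; have [df Df] := Cf; have [dg Dg] := Cg; split=> [x Ux|v].
  by apply: differentiableM; [exact: df|exact: dg].
have C : Ck_on k U (f * 'D_v g + g * 'D_v f).
  by apply: Ck_onD => //; apply: IH;
    [exact: Ck_onW|exact: Dg|exact: Ck_onW|exact: Df].
apply: Ck_on_congr C => // x Ux.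
by rewrite deriveM; [|exact/diff_derivable/df|exact/diff_derivable/dg].
Qed.

Lemma Ck_onV k U (f : V -> R) : open U -> (forall x, U x -> f x != 0) ->
  Ck_on k U f -> Ck_on k U (fun x => (f x)^-1).
Proof.
move=> Uo f0; elim: k => [|k IH].
  by move=> cf x Ux; apply: continuousV; [exact: f0|exact: cf].
move=> Cf; have [df Df] := Cf; split=> [x Ux|v].
  by apply: differentiableV; [exact: df|exact: f0].
have Ci := IH (Ck_onW Cf).
have C : Ck_on k U (cst (-1) *
  ((fun x => (f x)^-1) * (fun x => (f x)^-1) * 'D_v f)).
  by apply: Ck_onM => //; [exact: Ck_on_cst|apply: Ck_onM => //;
    [exact: Ck_onM|exact: Df]].
apply: Ck_on_congr C => // x Ux.
rewrite deriveV ?f0//; last exact/diff_derivable/df.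
by rewrite !fctE mulN1r -invfM -expr2 -mulNr.
Qed.

(** The chain rule for the composite with a function of one variable, which is
    only differentiated on the range of f. *)
Lemma Ck_on_comp1 k U (f : V -> R) (h h' : R -> R) : open U ->
  (forall x, U x -> is_derive (f x) 1 h (h' (f x))) ->
  Ck_on k.+1 U f -> Ck_on k U (h' \o f) -> Ck_on k.+1 U (h \o f).
Proof.
move=> Uo dh Cf Ch'; have [df Df] := Cf.
have dhf x : U x -> differentiable h (f x).
  by move=> Ux; apply/derivable1_diffP;
    exact: (@ex_derive _ _ _ _ _ _ _ (dh x Ux)).
split=> [x Ux|v].
  by apply: differentiable_comp; [exact: df|exact: dhf].
have C : Ck_on k U ((h' \o f) * 'D_v f).
  by apply: Ck_onM => //; exact: Df.
apply: Ck_on_congr C => // x Ux.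
rewrite deriveE; last by apply: differentiable_comp; [exact: df|exact: dhf].
rewrite diff_comp; [|exact: df|exact: dhf].
rewrite /= deriv1E; last by apply/derivable1_diffP; exact: dhf.
rewrite derive1E (@derive_val _ _ _ _ _ _ _ (dh x Ux)) !fctE /= deriveE;
  last exact: df.
exact: mulrC.
Qed.

Lemma Ck_on_expR k U (f : V -> R) : open U -> Ck_on k U f ->
  Ck_on k U (expR \o f).
Proof.
move=> Uo; elim: k => [|k IH] Cf.
  by move=> x Ux; apply: continuous_comp; [exact: Cf|exact: continuous_expR].
by apply: Ck_on_comp1 (IH (Ck_onW Cf)).
Qed.

Lemma Ck_on_ln k U (f : V -> R) : open U -> (forall x, U x -> 0 < f x) ->
  Ck_on k U f -> Ck_on k U (@ln R \o f).
Proof.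
move=> Uo f0; elim: k => [|k IH] Cf.
  by move=> x Ux; apply: continuous_comp; [exact: Cf|exact/continuous_ln/f0].
apply: (@Ck_on_comp1 _ _ _ _ GRing.inv) => //.
  by move=> x Ux; exact/is_derive1_ln/f0.
by apply: Ck_onV (Ck_onW Cf) => // x /f0 /lt0r_neq0.
Qed.

End CkClosure.

Section SmoothMatrices.
Context (R : realType) (V : normedModType R).
Implicit Types (U : set V) (W : normedModType R).

Lemma Ck_on_mxP m n k U (A : V -> 'M[R]_(m, n)) : open U ->
  Ck_on k U A <-> forall i j, Ck_on k U (fun x => A x i j).
Proof.
move=> Uo; split; elim: k A => [|k IH] A.
- move=> cA i j x Ux.
  exact: (cvg_comp _ _ (cA x Ux) (@coord_continuous _ _ _ i j (A x))).
- case=> dA DA i j; split=> [x Ux|v].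
    exact: (differentiable_comp (dA x Ux) (differentiable_coord (A x) i j)).
  apply: Ck_on_congr (IH _ (DA v) i j) => // x Ux.
  by rewrite derive_mx ?mxE//; exact/diff_derivable/dA.
- move=> cA x Ux; apply/cvgrPdist_le => /= e e0.
  near=> y.
  rewrite /Num.Def.normr/= mx_normrE (bigmax_le _ (ltW e0))//= => -[i j] _.
  rewrite !mxE/=; move: (i) (j); near: y.
  apply: filter_forall => i'; apply: filter_forall => j'.
  by have /cvgrPdist_le := cA i' j' x Ux; exact.
- move=> CA; split=> [x Ux|v].
    have -> : A = \sum_i \sum_j (fun y => A y i j *: delta_mx i j).
      apply/funext => y; rewrite [LHS]matrix_sum_delta.
      rewrite fct_sumE; apply: eq_bigr => i _.
      by rewrite fct_sumE.
    apply: differentiable_sum => i; apply: differentiable_sum => j.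
    by apply: differentiableZl; have [+ _] := CA i j; exact.
  apply: IH => i j; have [dA DA] := CA i j.
  apply: Ck_on_congr (DA v) => // x Ux.
  rewrite derive_mx ?mxE//; apply/derivable_mxP => i' j'.
  by apply: diff_derivable; have [+ _] := CA i' j'; exact.
Unshelve. all: by end_near. Qed.

Lemma smooth_on_congr U W (f g : V -> W) : open U ->
  (forall x, U x -> f x = g x) -> smooth_on U f -> smooth_on U g.
Proof. by move=> Uo fg Cf k; exact: Ck_on_congr (Cf k). Qed.

Lemma smooth_on_sub U U' W (f : V -> W) : U' `<=` U ->
  smooth_on U f -> smooth_on U' f.
Proof. by move=> sU Cf k; exact: Ck_on_sub (Cf k). Qed.

Lemma smooth_on_differentiable U W (f : V -> W) x :
  smooth_on U f -> U x -> differentiable f x.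
Proof. by move=> /(_ 1) [df _]; exact: df. Qed.

Lemma smooth_on_derivable U W (f : V -> W) x v :
  smooth_on U f -> U x -> derivable f x v.
Proof. by move=> sf Ux; exact/diff_derivable/(smooth_on_differentiable sf). Qed.

Lemma smooth_on_derive U W (f : V -> W) v :
  smooth_on U f -> smooth_on U ('D_v f).
Proof. by move=> sf k; have [_] := sf k.+1; exact. Qed.

Lemma smooth_on_cst U W (w : W) : smooth_on U (fun _ : V => w).
Proof. by move=> k; exact: Ck_on_cst. Qed.

Lemma smooth_onD U W (f g : V -> W) : open U ->
  smooth_on U f -> smooth_on U g -> smooth_on U (fun x => f x + g x).
Proof. by move=> Uo sf sg k; exact: Ck_onD. Qed.

Lemma smooth_onM U (f g : V -> R) : open U ->
  smooth_on U f -> smooth_on U g -> smooth_on U (fun x => f x * g x).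
Proof. by move=> Uo sf sg k; exact: Ck_onM. Qed.

Lemma smooth_onV U (f : V -> R) : open U -> (forall x, U x -> f x != 0) ->
  smooth_on U f -> smooth_on U (fun x => (f x)^-1).
Proof. by move=> Uo f0 sf k; exact: Ck_onV. Qed.

Lemma smooth_on_sum U W I (r : seq I) (P : pred I) (f : I -> V -> W) : open U ->
  (forall i, smooth_on U (f i)) ->
    smooth_on U (fun x => \sum_(i <- r | P i) f i x).
Proof.
move=> Uo sf; rewrite -fct_sumE; elim/big_rec: _ => [|i g _ sg].
  exact: smooth_on_cst.
exact: smooth_onD.
Qed.

Lemma smooth_on_prod U I (r : seq I) (P : pred I) (f : I -> V -> R) : open U ->
  (forall i, smooth_on U (f i)) ->
    smooth_on U (fun x => \prod_(i <- r | P i) f i x).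
Proof.
move=> Uo sf; rewrite -fct_prodE; elim/big_rec: _ => [|i g _ sg].
  exact: smooth_on_cst.
exact: smooth_onM.
Qed.

Lemma smooth_on_mxP m n U (A : V -> 'M[R]_(m, n)) : open U ->
  smooth_on U A <-> forall i j, smooth_on U (fun x => A x i j).
Proof.
move=> Uo; split=> sA.
  by move=> i j k; have /(Ck_on_mxP _ _ Uo) := sA k; exact.
by move=> k; apply/Ck_on_mxP => // i j; exact: sA.
Qed.

Lemma smooth_on_mulmx m n p U (A : V -> 'M[R]_(m, n)) (B : V -> 'M[R]_(n, p)) :
  open U -> smooth_on U A -> smooth_on U B ->
  smooth_on U (fun x => A x *m B x).
Proof.
move=> Uo /smooth_on_mxP sA /smooth_on_mxP sB; apply/smooth_on_mxP => // i j.
apply: (@smooth_on_congr _ _ (fun x => \sum_k A x i k * B x k j)) => //.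
  by move=> x _; rewrite mxE.
by apply: smooth_on_sum => // k; apply: smooth_onM; [|exact: sA|exact: sB].
Qed.

Lemma smooth_on_trmx m n U (A : V -> 'M[R]_(m, n)) : open U ->
  smooth_on U A -> smooth_on U (fun x => (A x)^T).
Proof.
move=> Uo /smooth_on_mxP sA; apply/smooth_on_mxP => // i j.
by apply: (smooth_on_congr Uo _ (sA Uo j i)) => x _; rewrite mxE.
Qed.

Lemma smooth_onZ m n U (a : V -> R) (A : V -> 'M[R]_(m, n)) : open U ->
  smooth_on U a -> smooth_on U A -> smooth_on U (fun x => a x *: A x).
Proof.
move=> Uo sa /smooth_on_mxP sA; apply/smooth_on_mxP => // i j.
by apply: (smooth_on_congr Uo _ (smooth_onM Uo sa (sA Uo i j))) => x _;
  rewrite mxE.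
Qed.

Lemma smooth_on_opp m n U (A : V -> 'M[R]_(m, n)) : open U ->
  smooth_on U A -> smooth_on U (fun x => - A x).
Proof.
move=> Uo sA; apply: (@smooth_on_congr _ _ (fun x => -1 *: A x)) => //.
  by move=> x _; rewrite scaleN1r.
exact: (smooth_onZ Uo (smooth_on_cst U (-1 : R)) sA).
Qed.

Lemma smooth_on_det n U (A : V -> 'M[R]_n) : open U ->
  smooth_on U A -> smooth_on U (fun x => \det (A x)).
Proof.
move=> Uo /smooth_on_mxP sA; apply: smooth_on_sum => // s.
apply: smooth_onM => //; first exact: smooth_on_cst.
by apply: smooth_on_prod => // i; exact: sA.
Qed.

Lemma smooth_on_invmx n U (A : V -> 'M[R]_n) : open U ->
  (forall x, U x -> A x \in unitmx) ->
  smooth_on U A -> smooth_on U (fun x => invmx (A x)).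
Proof.
move=> Uo uA sA; apply/smooth_on_mxP => // i j.
apply: (@smooth_on_congr _ _ (fun x => (\det (A x))^-1 * cofactor (A x) j i)) =>
  //.
  by move=> x Ux; rewrite /invmx uA// !mxE.
apply: smooth_onM => //.
  apply: smooth_onV => //; last exact: smooth_on_det.
  by move=> x /uA; rewrite unitmxE unitfE.
apply: smooth_onM => //; first exact: smooth_on_cst.
apply: smooth_on_det => //; apply/smooth_on_mxP => // k l.
move/(smooth_on_mxP _ Uo): sA => /(_ (lift j k) (lift i l)).
by apply: smooth_on_congr => // x _; rewrite !mxE.
Qed.

Lemma derive_mulmx m n p (A : V -> 'M[R]_(m, n)) (B : V -> 'M[R]_(n, p)) x v :
  derivable A x v -> derivable B x v ->
  'D_v (fun y => A y *m B y) x = 'D_v A x *m B x + A x *m 'D_v B x.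
Proof.
move=> dA dB.
have dA' := (derivable_mxP _ _ _).1 dA; have dB' := (derivable_mxP _ _ _).1 dB.
have E i j : (fun y => (A y *m B y) i j) =
    \sum_k ((fun y => A y i k) * (fun y => B y k j)).
  by apply/funext => y; rewrite mxE fct_sumE.
rewrite derive_mx; last first.
  apply/derivable_mxP => i j; rewrite E.
  by apply: derivable_sum => k; exact: derivableM.
apply/matrixP => i j; rewrite !mxE E derive_sum; last first.
  by move=> k; exact: derivableM.
rewrite -big_split; apply: eq_bigr => k _ /=.
rewrite deriveM; [|exact: dA'|exact: dB'].
rewrite (derive_mx dA) (derive_mx dB) !mxE addrC; congr (_ + _).
exact: mulrC.
Qed.

Lemma derive_trmx m n (A : V -> 'M[R]_(m, n)) x v :
  derivable A x v -> 'D_v (fun y => (A y)^T) x = ('D_v A x)^T.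
Proof.
move=> dA; rewrite derive_mx.
  rewrite (derive_mx dA); apply/matrixP => i j; rewrite !mxE.
  by congr ('D_v _ x); apply/funext => y; rewrite mxE.
apply/derivable_mxP => i j.
have -> : (fun y => (A y)^T i j) = (fun y => A y j i).
  by apply/funext => y; rewrite mxE.
exact: (derivable_mxP _ _ _).1 dA j i.
Qed.

Lemma derive_scalemx m n (a : V -> R) (A : V -> 'M[R]_(m, n)) x v :
  derivable a x v -> derivable A x v ->
  'D_v (fun y => a y *: A y) x = 'D_v a x *: A x + a x *: 'D_v A x.
Proof.
move=> da dA; have dA' := (derivable_mxP _ _ _).1 dA.
have E i j : (fun y => (a y *: A y) i j) = a * (fun y => A y i j).
  by apply/funext => y; rewrite mxE.
rewrite derive_mx; last first.
  by apply/derivable_mxP => i j; rewrite E; exact: derivableM.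
apply/matrixP => i j; rewrite mxE E deriveM; [|exact: da|exact: dA'].
rewrite (derive_mx dA) !mxE addrC; congr (_ + _).
exact: mulrC.
Qed.

Lemma col_mx_entry m1 m2 n (A : V -> 'M[R]_(m1, n)) (B : V -> 'M[R]_(m2, n)) i j
  :
  (fun y => col_mx (A y) (B y) i j) =
  match fintype.split i with inl k => fun y => A y k j | inr k => fun y =>
    B y k j end.
Proof. by apply/funext => y; rewrite mxE; case: fintype.split. Qed.

Lemma smooth_on_col_mx m1 m2 n U (A : V -> 'M[R]_(m1, n))
  (B : V -> 'M[R]_(m2, n)) :
  open U -> smooth_on U A -> smooth_on U B ->
  smooth_on U (fun y => col_mx (A y) (B y)).
Proof.
move=> Uo sA sB; apply/smooth_on_mxP => // i j; rewrite col_mx_entry.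
case: fintype.split => k.
  exact: (smooth_on_mxP _ Uo).1 sA k j.
exact: (smooth_on_mxP _ Uo).1 sB k j.
Qed.

Lemma derive_col_mx m1 m2 n (A : V -> 'M[R]_(m1, n)) (B : V -> 'M[R]_(m2, n)) x
  v :
  derivable A x v -> derivable B x v ->
  'D_v (fun y => col_mx (A y) (B y)) x = col_mx ('D_v A x) ('D_v B x).
Proof.
move=> dA dB; rewrite derive_mx; last first.
  apply/derivable_mxP => i j; rewrite col_mx_entry; case: fintype.split => k.
    exact: (derivable_mxP _ _ _).1 dA k j.
  exact: (derivable_mxP _ _ _).1 dB k j.
apply/matrixP => i j; rewrite mxE col_mx_entry [RHS]mxE;
  case: fintype.split => k.
  by rewrite (derive_mx dA) mxE.
by rewrite (derive_mx dB) mxE.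
Qed.

End SmoothMatrices.

(** * Symmetry of second derivatives *)

Section Clairaut.
Context (R : realType) (V : normedModType R).
Implicit Types (U : set V) (f : V -> R).

Lemma is_derive_line f (a v : V) (t : R) : differentiable f (t *: v + a) ->
  is_derive t (1 : R) (fun s : R => f (s *: v + a)) ('D_v f (t *: v + a)).
Proof.
move=> df; pose l : R -> V := fun s => s *: v + a.
have dl : is_diff t l ( *:%R^~ v).
  have -> : ( *:%R^~ v) = ( *:%R^~ v) + 0 :> (R -> V) by rewrite addr0.
  exact: is_diffD.
have dfl : differentiable (f \o l) t by apply: differentiable_comp.
apply: DeriveDef; first exact/derivable1_diffP.
rewrite -[LHS]/('D_1 (f \o l) t) deriveE// diff_comp// deriveE// /=.
by rewrite (diff_val (f := l)) scale1r.
Qed.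

(** Up to an error bounded by a multiple of e h^2, the second difference of f
    along h v and h w is h^2 D_w (D_v f). By the mean value theorem it is h
    times an increment of D_v f, which is estimated by the differentiability
    of D_v f at x; continuity of the second derivatives is not needed. *)
Lemma derive2_quotient U f (v w x : V) (e : R) : open U -> U x ->
  (forall y, U y -> differentiable f y) -> differentiable ('D_v f) x -> 0 < e ->
  \forall h \near 0^'+, `|f (h *: v + (h *: w + x)) - f (h *: v + x)
      - (f (h *: w + x) - f x) - h ^+ 2 * 'D_w ('D_v f) x|
    <= h ^+ 2 * (e * (2 * `|v| + `|w|)).
Proof.
move=> Uo Ux df ddf e0.
have /diff_locallyP[_ /eqaddoP /(_ _ e0)] := ddf.
have : \forall y \near 0, U (y + x).
  move: (near_open (P := U) Uo Ux (fun=> id)); rewrite (near_shift 0 x).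
  by apply: filterS => h /=; rewrite subr0.
move=> Un bn; have [r /= r0 Br] := (nbhs_ballP _ _).1 (filterI Un bn).
have vw0 : 0 < `|v| + `|w| + 1 by rewrite ltr_wpDl// addr_ge0.
near=> h.
have h0 : 0 < h by near: h; exact: nbhs_right_gt.
(* The parallelogram spanned by h v and h w lies in the ball of radius r. *)
have hr : h * (`|v| + `|w| + 1) < r.
  by rewrite -ltr_pdivlMr//; near: h; apply: nbhs_right_lt; rewrite divr_gt0.
have inB s t : 0 <= s <= h -> 0 <= t <= h -> ball 0 r (s *: v + t *: w).
  move=> /andP[s0 sh] /andP[t0 th]; rewrite -ball_normE/= sub0r normrN.
  apply: le_lt_trans hr; rewrite (le_trans (ler_normD _ _))// !normrZ.
  rewrite !ger0_norm// mulrDr mulrDr -[leLHS]addr0 !lerD ?ler_wpM2r//.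
  by rewrite mulr1 ltW.
have hh : 0 <= h <= h by rewrite lexx ltW.
have z0 : 0 <= (0 : R) <= h by rewrite lexx ltW.
pose g s := f (s *: v + (h *: w + x)) - f (s *: v + x).
pose g' s := 'D_v f (s *: v + (h *: w + x)) - 'D_v f (s *: v + x).
have dg s : 0 <= s <= h -> is_derive s (1 : R) g (g' s).
  move=> sh; apply: is_deriveB; apply: is_derive_line; apply: df.
    by have [+ _] := Br _ (inB s h sh hh); rewrite /= addrA.
  by have [+ _] := Br _ (inB s 0 sh z0); rewrite /= scale0r addr0.
have [||c] := @MVT R g g' 0 h h0.
- by move=> s /itvP sh; apply: dg; rewrite !sh.
- apply: derivable_within_continuous => s /itvP sh.
  by apply: (@ex_derive _ _ _ _ _ _ _ (dg s _)); rewrite !sh.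
move=> /itvP ch; rewrite subr0 => gE.
have ch' : 0 <= c <= h by rewrite !ch.
have [_ /= b1] := Br _ (inB c h ch' hh);
  have [_ /= b2] := Br _ (inB c 0 ch' z0).
move: b1 b2; rewrite /= !fctE /= !scale0r !addr0 -[X in 'D_v f X]addrA.
set D := 'D_v f; set A := 'd D x => b1 b2.
have -> : f (h *: v + (h *: w + x)) - f (h *: v + x) - (f (h *: w + x) - f x)
   = g' c * h.
  by rewrite -gE /g !scale0r !add0r.
rewrite [X in _ - _ * X]deriveE// -/A.
have AE : A (c *: v + h *: w) = A (c *: v) + h * A w.
  by rewrite [LHS]linearD [A (h *: w)]linearZ.
have n1 : `|c *: v + h *: w| <= h * (`|v| + `|w|).
  rewrite (le_trans (ler_normD _ _))// !normrZ mulrDr (gtr0_norm h0).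
  by rewrite ger0_norm ?lerD2r ?ler_wpM2r ?ch//; case/andP: ch'.
have n2 : `|c *: v| <= h * `|v|.
  by rewrite normrZ ger0_norm ?ler_wpM2r ?ch//; case/andP: ch'.
move: b1 b2; rewrite AE /g'.
move: ('D_v f (c *: v + (h *: w + x))) ('D_v f (c *: v + x)) ('D_v f x) (A w)
  (A (c *: v)) => p q s a b b1 b2.
have -> : (p - q) * h - h ^+ 2 * a =
  h * ((p - (s + (b + h * a))) - (q - (s + b))).
  by rewrite expr2; ring.
rewrite normrM (gtr0_norm h0) expr2 -[leRHS]mulrA ler_pM2l//.
rewrite (le_trans (ler_normB _ _))// (le_trans (lerD b1 b2))// -mulrDr.
rewrite [leRHS]mulrCA ler_pM2l// (le_trans (lerD n1 n2))// -mulrDr ler_pM2l//.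
by lra.
Unshelve. all: by end_near. Qed.

(** Symmetry of second derivatives holds because the second difference is
    symmetric in v and w. *)
Lemma derive_comm_fct U f (v w x : V) : open U -> U x ->
  (forall y, U y -> differentiable f y) ->
  differentiable ('D_v f) x -> differentiable ('D_w f) x ->
  'D_w ('D_v f) x = 'D_v ('D_w f) x.
Proof.
move=> Uo Ux df ddv ddw; apply/eqP; rewrite -subr_eq0 -normr_le0.
pose K := 2 * `|v| + `|w| + (2 * `|w| + `|v|) + 1.
have K0 : 0 < K by rewrite ltr_wpDl// !addr_ge0// mulr_ge0.
apply/ler_addgt0Pr => eps eps0; rewrite add0r.
have e0 : 0 < eps / K by rewrite divr_gt0.
near (0 : R)^'+ => h.
have h0 : 0 < h by near: h; exact: nbhs_right_gt.
have bv : `|f (h *: v + (h *: w + x)) - f (h *: v + x)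
      - (f (h *: w + x) - f x) - h ^+ 2 * 'D_w ('D_v f) x|
    <= h ^+ 2 * (eps / K * (2 * `|v| + `|w|)).
  by near: h; exact: derive2_quotient Uo Ux df ddv e0.
have bw : `|f (h *: w + (h *: v + x)) - f (h *: w + x)
      - (f (h *: v + x) - f x) - h ^+ 2 * 'D_v ('D_w f) x|
    <= h ^+ 2 * (eps / K * (2 * `|w| + `|v|)).
  by near: h; exact: derive2_quotient Uo Ux df ddw e0.
have h2 : 0 < h ^+ 2 by rewrite exprn_gt0.
rewrite -(ler_pM2l h2) -{1}(gtr0_norm h2) -normrM.
have -> : eps = eps / K * K by rewrite divfK// gt_eqF.
move: bv bw; rewrite [h *: w + (h *: v + x)]addrCA.
move: (f (h *: v + (h *: w + x))) (f (h *: v + x)) (f (h *: w + x)) (f x).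
move: ('D_w ('D_v f) x) ('D_v ('D_w f) x) => a b p q r s bv bw.
have -> : h ^+ 2 * (a - b) = (p - r - (q - s) - h ^+ 2 * b) -
  (p - q - (r - s) - h ^+ 2 * a) by ring.
rewrite (le_trans (ler_normB _ _))// (le_trans (lerD bw bv))// -mulrDr -mulrDr.
by rewrite ler_pM2l// ler_pM2l// /K; lra.
Unshelve. all: by end_near. Qed.

End Clairaut.

Lemma derive_comm (R : realType) (V : normedModType R) m n (U : set V)
    (A : V -> 'M[R]_(m, n)) (v w x : V) : open U -> smooth_on U A -> U x ->
  'D_w ('D_v A) x = 'D_v ('D_w A) x.
Proof.
move=> Uo sA Ux.
have E (a b : V) i j : ('D_a ('D_b A) x) i j = 'D_a ('D_b (fun y => A y i j)) x.
  rewrite derive_mx ?mxE; last exact: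
    smooth_on_derivable (smooth_on_derive b sA) Ux.
  apply: derive_congr Uo Ux _ => y Uy.
  by rewrite derive_mx ?mxE//; exact: smooth_on_derivable sA Uy.
have sAij i j := (smooth_on_mxP _ Uo).1 sA i j.
apply/matrixP => i j.
apply: etrans (E w v i j) (etrans _ (esym (E v w i j))).
apply: (derive_comm_fct Uo Ux).
- by move=> y; exact: smooth_on_differentiable.
- exact: smooth_on_differentiable (smooth_on_derive v (sAij i j)) Ux.
- exact: smooth_on_differentiable (smooth_on_derive w (sAij i j)) Ux.
Qed.

(** * Normal projections and the Ricci equation *)

(** Transpose with respect to the Lorentzian form: for row vectors u and v, the
    only entry of u *m v^L is their Lorentzian product, and the Gram matrix of
    the rows of B is B *m B^L. *)
Local Notation "u ^L" := (lorentz_mx _ _ *m u^T) (at level 2, format "u ^L").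

Section NormalProjection.
Context (R : realType) (n : nat).
Local Notation L := (lorentz_mx R n).

Lemma trmx_lorentz : L^T = L.
Proof. exact: tr_diag_mx. Qed.

Lemma lorentz_mxK : L *m L = 1%:M.
Proof.
rewrite mulmx_diag -diag_const_mx; congr diag_mx; apply/rowP => i.
by rewrite !mxE; case: ifP => _; rewrite ?mulrNN mulr1.
Qed.

Lemma lorentz_adjoint p q (A : 'M[R]_(p, 2 * n)) (B : 'M[R]_(q, 2 * n)) :
  (A *m B^L)^T = B *m A^L.
Proof. by rewrite trmx_mul trmx_mul trmxK trmx_lorentz mulmxA. Qed.

Lemma lorentz_orthC p q (A : 'M[R]_(p, 2 * n)) (B : 'M[R]_(q, 2 * n)) :
  A *m B^L = 0 -> B *m A^L = 0.
Proof. by move=> AB0; rewrite -lorentz_adjoint AB0 trmx0. Qed.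

Lemma lorentz_nondegenerate (z : 'rV[R]_(2 * n)) :
  (forall w : 'rV[R]_(2 * n), z *m w^L = 0) -> z = 0.
Proof.
move=> z0; rewrite -[z]mulmx1 -lorentz_mxK mulmxA.
suff -> : z *m L = 0 by rewrite mul0mx.
apply/rowP => k; rewrite mxE.
have := z0 (delta_mx 0 k); rewrite mulmxA trmx_delta -colE.
by move/matrixP => /(_ 0 0); rewrite !mxE.
Qed.

Variables (k : nat) (B : 'M[R]_(k, 2 * n)).

Lemma gramE : gram B = B *m B^L.
Proof. by rewrite /gram mulmxA. Qed.

Lemma trmx_gram : (gram B)^T = gram B.
Proof. by rewrite gramE lorentz_adjoint. Qed.

(** Right multiplication by this matrix gives the coordinates, in the rows of
    B, of the tangential part of a row vector, when the Gram matrix of B is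
    invertible. *)
Definition tangent_coord : 'M[R]_(2 * n, k) := B^L *m invmx (gram B).

(** The matrix of the orthogonal projection onto the orthogonal complement of
    the rows of B, when their Gram matrix is invertible; it acts on row vectors
    from the right. *)
Definition normal_mx : 'M[R]_(2 * n) := 1%:M - tangent_coord *m B.

Lemma normal_projE v : normal_proj B v = v *m normal_mx.
Proof. by rewrite /normal_proj mulmxBr mulmx1 !mulmxA. Qed.

Lemma normal_mx_tr : normal_mx *m L = L *m normal_mx^T.
Proof.
rewrite /normal_mx linearB /= trmx1 mulmxBl mulmxBr mul1mx mulmx1;
  congr (_ - _).
by rewrite /tangent_coord !trmx_mul trmxK trmx_lorentz trmx_inv trmx_gram
  !mulmxA.
Qed.

Lemma mulmx_normalL p (A : 'M[R]_(p, 2 * n)) : normal_mx *m A^L =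
  (A *m normal_mx)^L.
Proof. by rewrite mulmxA normal_mx_tr -mulmxA trmx_mul. Qed.

Lemma normal_mx_id p (A : 'M[R]_(p, 2 * n)) : A *m B^L = 0 -> A *m normal_mx =
  A.
Proof.
by move=> AB; rewrite /normal_mx /tangent_coord mulmxBr mulmx1 !mulmxA
  -[A *m L *m _]mulmxA AB
  !mul0mx subr0.
Qed.

Hypothesis uB : gram B \in unitmx.

Lemma tangent_coordK : tangent_coord *m gram B = B^L.
Proof. by rewrite mulmxKV. Qed.

Lemma mulmx_normal : B *m normal_mx = 0.
Proof.
by rewrite /normal_mx mulmxBr mulmx1 !mulmxA -/(gram B) mulmxV// mul1mx subrr.
Qed.

Lemma normal_mx_orth p (A : 'M[R]_(p, 2 * n)) : (A *m normal_mx) *m B^L = 0.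
Proof. by rewrite -mulmxA mulmx_normalL mulmx_normal trmx0 !mulmx0. Qed.

Lemma normal_mx_idem : normal_mx *m normal_mx = normal_mx.
Proof. by apply: normal_mx_id; have := normal_mx_orth 1%:M; rewrite mul1mx. Qed.

End NormalProjection.

Section Ricci.
Context (R : realType) (n k : nat) (U : set 'rV[R]_n).
Variable B : 'rV[R]_n -> 'M[R]_(k, 2 * n).
Local Notation L := (lorentz_mx R n).

(** The shape operators of any two normal vectors v and w commute: each side
    pairs v and w with the derivatives of the frame in the directions i and j,
    and contracts with the inverse Gram matrix. *)
Definition shape_operators_commute (x : 'rV[R]_n) : Prop :=
  forall v w : 'rV[R]_(2 * n), B x *m v^L = 0 -> B x *m w^L = 0 -> forall i j,
    v *m (partial j B x)^L *m invmx (gram (B x)) *m (partial i B x *m w^L) =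
    v *m (partial i B x)^L *m invmx (gram (B x)) *m (partial j B x *m w^L).

Hypotheses (Uo : open U) (sB : smooth_on U B).
Hypothesis uB : forall x, U x -> gram (B x) \in unitmx.

Lemma smooth_on_gram : smooth_on U (fun x => gram (B x)).
Proof.
apply: smooth_on_mulmx => //; last exact: smooth_on_trmx.
by apply: smooth_on_mulmx => //; exact: smooth_on_cst.
Qed.

Lemma smooth_on_tangent_coord : smooth_on U (fun x => tangent_coord (B x)).
Proof.
apply: smooth_on_mulmx => //; last by apply: smooth_on_invmx => //;
  exact: smooth_on_gram.
by apply: smooth_on_mulmx => //; [exact: smooth_on_cst|exact: smooth_on_trmx].
Qed.

Lemma smooth_on_normal_mx : smooth_on U (fun x => normal_mx (B x)).
Proof.
apply: smooth_onD => //; first exact: smooth_on_cst.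
apply: smooth_on_opp => //; apply: smooth_on_mulmx => //.
exact: smooth_on_tangent_coord.
Qed.

Lemma partial_lorentz p q (F : 'rV[R]_n -> 'M[R]_(p, 2 * n))
    (G : 'rV[R]_n -> 'M[R]_(q, 2 * n)) i x : U x ->
  smooth_on U F -> smooth_on U G ->
  partial i (fun y => F y *m (G y)^L) x =
    partial i F x *m (G x)^L + F x *m (partial i G x)^L.
Proof.
move=> Ux sF sG; have dF := smooth_on_derivable (v := delta_mx 0 i) sF Ux.
have dG := smooth_on_derivable (v := delta_mx 0 i) sG Ux.
have sGt := smooth_on_trmx Uo sG.
have sGL : smooth_on U (fun y => (G y)^L).
  by apply: smooth_on_mulmx => //; exact: smooth_on_cst.
rewrite /partial derive_mulmx//; last exact: smooth_on_derivable sGL Ux.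
congr (_ + _ *m _).
rewrite derive_mulmx; [|exact: derivable_cst|exact: smooth_on_derivable sGt Ux].
by rewrite derive_cst mul0mx add0r derive_trmx.
Qed.

(** Composed with the normal projection, only the derivative of the frame
    itself contributes to the derivative of the projection. *)
Lemma partial_normal_mx i x : U x ->
  partial i (fun y => normal_mx (B y)) x *m normal_mx (B x) =
  - tangent_coord (B x) *m partial i B x *m normal_mx (B x).
Proof.
move=> Ux; have sC := smooth_on_tangent_coord.
have dB := smooth_on_derivable (v := delta_mx 0 i) sB Ux.
have dC := smooth_on_derivable (v := delta_mx 0 i) sC Ux.
have sCB := smooth_on_mulmx Uo sC sB.
have -> : partial i (fun y => normal_mx (B y)) x =
    - (partial i (fun y => tangent_coord (B y)) x *m B x
       + tangent_coord (B x) *m partial i B x).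
  rewrite /partial -derive_mulmx//.
  have dCB := smooth_on_derivable (v := delta_mx 0 i) sCB Ux.
  have dI := derivable_cst (1%:M : 'M[R]_(2 * n)) x (delta_mx 0 i).
  by have := deriveB dI dCB; rewrite derive_cst sub0r.
by rewrite !mulNmx mulmxDl -[X in X + _]mulmxA (mulmx_normal (uB Ux)) mulmx0
  add0r.
Qed.

Lemma smooth_on_partial (W : normedModType R) (f : 'rV[R]_n -> W) i :
  smooth_on U f -> smooth_on U (partial i f).
Proof. exact: smooth_on_derive. Qed.

(** The Ricci equation: no derivative of xi is left, because the product
    B *m xi^L vanishes on the whole of U. *)
Lemma normal_curvatureE xi i j x : normal_section U B xi -> U x ->
  normal_curvature B i j xi x =
  (xi x *m (partial j B x)^L *m invmx (gram (B x)) *m partial i B x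
   - xi x *m (partial i B x)^L *m invmx (gram (B x)) *m partial j B x)
  *m normal_mx (B x).
Proof.
move=> [sxi nxi] Ux; have sP := smooth_on_normal_mx.
have connE a : normal_connection B a xi =
    fun y => partial a xi y *m normal_mx (B y).
  by apply/funext => y; exact: normal_projE.
have curvE a b : normal_connection B a (normal_connection B b xi) x =
    partial a (partial b xi) x *m normal_mx (B x) +
    xi x *m (partial b B x)^L *m invmx (gram (B x)) *m partial a B x *m
      normal_mx (B x).
  rewrite {1}/normal_connection normal_projE connE /partial derive_mulmx.
  - rewrite mulmxDl -[X in X + _]mulmxA (normal_mx_idem (uB Ux)); congr (_ + _).
    rewrite -mulmxA [X in _ *m X](partial_normal_mx a Ux) !mulmxA;
      congr (_ *m _ *m _).
    rewrite mulmxN /tangent_coord !mulmxA -mulNmx; congr (_ *m _).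
    apply/esym/eqP; rewrite -addr_eq0 addrC -!mulmxA; apply/eqP.
    rewrite -[LHS](partial_lorentz b Ux sxi sB).
    rewrite /partial (derive_congr (g := cst 0) _ Uo Ux) ?derive_cst// => y Uy.
    by apply: lorentz_orthC; rewrite mulmxA nxi.
  - exact: smooth_on_derivable (smooth_on_partial b sxi) Ux.
  - exact: smooth_on_derivable sP Ux.
have swap : partial i (partial j xi) x = partial j (partial i xi) x.
  exact: derive_comm Uo sxi Ux.
rewrite /normal_curvature (curvE i j) (curvE j i) swap.
by rewrite opprD addrACA subrr add0r -mulmxBl.
Qed.

End Ricci.

(** The bundle orthogonal to the rows of B is flat over U if and only if its
    shape operators commute.  The direct implication tests the curvature on the
    normal projections of constant vectors. *)
Lemma flat_complement_chartP (R : realType) n k (U : set 'rV[R]_n)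
    (B : 'rV[R]_n -> 'M[R]_(k, 2 * n)) : open U -> smooth_on U B ->
      (forall x, U x -> gram (B x) \in unitmx) ->
  (forall U' : set 'rV[R]_n, open U' -> U' `<=` U ->
   forall xi, normal_section U' B xi ->
   forall i j x, U' x -> normal_curvature B i j xi x = 0)
  <-> (forall x, U x -> shape_operators_commute B x).
Proof.
move=> Uo sB uB; split=> [flatB x Ux v w Bv Bw i j|comm U' U'o sU xi nxi i j x
  U'x].
- have nxi : normal_section U B (fun y => v *m normal_mx (B y)).
    split=> [|y Uy].
      by apply: smooth_on_mulmx (smooth_on_cst _ _) (smooth_on_normal_mx _ _ _).
    by rewrite -mulmxA; apply: lorentz_orthC; exact/normal_mx_orth/uB.
  have vP := normal_mx_id (lorentz_orthC Bv).
  have wP := normal_mx_id (lorentz_orthC Bw).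
  have := flatB U Uo (@subset_refl _ _) _ nxi i j x Ux.
  rewrite (normal_curvatureE Uo sB uB i j nxi Ux) vP.
  move=> /(congr1 (mulmx^~ (w^L)));
    rewrite mul0mx -[LHS]mulmxA mulmx_normalL wP.
  rewrite mulmxBl -[X in X - _]mulmxA -[X in _ - X]mulmxA.
  by move=> /eqP; rewrite subr_eq0 => /eqP.
- have [sxi nxi'] := nxi; have Ux := sU _ U'x.
  have sB' := smooth_on_sub sU sB.
  have uB' y (U'y : U' y) : gram (B y) \in unitmx := uB _ (sU _ U'y).
  rewrite (normal_curvatureE U'o sB' uB' i j nxi U'x).
  apply: lorentz_nondegenerate => w.
  rewrite -[LHS]mulmxA mulmx_normalL mulmxBl.
  have Bxi : B x *m (xi x)^L = 0 by rewrite mulmxA nxi'.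
  have Bw : B x *m (w *m normal_mx (B x))^L = 0.
    exact/lorentz_orthC/normal_mx_orth/uB.
  rewrite -[X in X - _]mulmxA -[X in _ - X]mulmxA.
  by apply/eqP; rewrite subr_eq0; apply/eqP; exact: comm.
Qed.

(** * The Gauss equation *)

Section Gauss.
Context (R : realType) (n : nat) (U : set 'rV[R]_n).
Variable F : 'rV[R]_n -> 'rV[R]_(2 * n).
Hypotheses (Uo : open U) (sF : smooth_on U F).
Local Notation J := (fun x => 'J F x).
Local Notation partial2 i j := (partial i (partial j F)).

Lemma row_jacobian i x : U x -> row i ('J F x) = partial i F x.
Proof.
move=> Ux; rewrite rowE; symmetry; apply: deriveEjacobian.
exact: smooth_on_differentiable sF Ux.
Qed.

Lemma smooth_on_jacobian : smooth_on U J.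
Proof.
apply/smooth_on_mxP => // i j.
have := (smooth_on_mxP _ Uo).1 (smooth_on_partial i sF) 0 j.
by apply: smooth_on_congr => // x Ux; rewrite -row_jacobian// mxE.
Qed.

Lemma row_partial_jacobian i j x : U x ->
  row j (partial i J x) = partial2 i j x.
Proof.
move=> Ux.
have dJ := smooth_on_derivable (v := delta_mx 0 i) smooth_on_jacobian Ux.
have dd := derivable_cst (delta_mx 0 j : 'rV[R]_n) x (delta_mx 0 i).
have := derive_mulmx dd dJ; rewrite derive_cst mul0mx add0r -rowE => <-.
apply: derive_congr Uo Ux _ => y Uy /=.
by rewrite -rowE row_jacobian.
Qed.

Lemma partial2_comm i j x : U x -> partial2 i j x = partial2 j i x.
Proof. by move=> Ux; exact: derive_comm Uo sF Ux. Qed.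

Hypothesis uF : forall x, U x -> gram ('J F x) \in unitmx.
Local Notation g := (fun x => gram ('J F x)).
Local Notation C := (fun x => tangent_coord ('J F x)).

Lemma smooth_on_gram_jacobian : smooth_on U g.
Proof. exact: smooth_on_gram smooth_on_jacobian. Qed.

Lemma partial_gram_jacobian i x : U x ->
  partial i g x = partial i J x *m ('J F x)^L + 'J F x *m (partial i J x)^L.
Proof.
move=> Ux; have := partial_lorentz Uo i Ux smooth_on_jacobian
  smooth_on_jacobian.
apply: etrans; apply: derive_congr Uo Ux _ => y _; exact: gramE.
Qed.

Lemma partial_gram_entry i j k x : U x ->
  partial i (fun y => g y j k) x =
  (partial2 i j x *m ('J F x)^L) 0 k + (partial2 i k x *m ('J F x)^L) 0 j.
Proof.
move=> Ux.
have dg := smooth_on_derivable (v := delta_mx 0 i) smooth_on_gram_jacobian Ux.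
transitivity (partial i g x j k); first by rewrite /partial (derive_mx dg) mxE.
rewrite partial_gram_jacobian// mxE -!(row_partial_jacobian i _ Ux) -!row_mul.
congr (_ + _); first by rewrite [RHS]mxE.
by rewrite -lorentz_adjoint mxE [RHS]mxE.
Qed.

(** The Christoffel symbols are the tangential coordinates of the second
    derivatives. *)
Lemma christoffelE l i j x : U x ->
  christoffel g l i j x = (partial2 i j x *m tangent_coord ('J F x)) 0 l.
Proof.
move=> Ux; rewrite /christoffel.
have [p pE pC] : exists2 p : 'I_n -> 'I_n -> 'I_n -> R,
    (forall a b c, p a b c = (partial2 a b x *m ('J F x)^L) 0 c) &
    (forall a b c, p a b c = p b a c).
  exists (fun a b c => (partial2 a b x *m ('J F x)^L) 0 c); first by [].
  move=> a b c /=.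
  by have /(congr1 (fun z : 'rV[R]_(2 * n) => (z *m ('J F x)^L) 0 c)) :=
    partial2_comm a b Ux.
have dgE a b c : partial a (fun y => g y b c) x = p a b c + p a c b.
  by rewrite !pE; exact: partial_gram_entry.
rewrite /tangent_coord mulmxA [RHS]mxE mulr_sumr; apply: eq_bigr => m _.
rewrite (dgE i j m) (dgE j i m) (dgE m i j) -pE.
rewrite (pC j i m) (pC m i j) (pC m j i).
have -> : invmx (g x) l m = invmx (g x) m l.
  by rewrite -[in LHS](trmx_gram ('J F x)) -trmx_inv mxE.
move: (p _ _ _) (p _ _ _) (p _ _ _) (invmx _ _ _) => a b c d.
by field.
Qed.

(** The left-hand side, without the Gram matrix, is the coefficient with which
    a second derivative of F enters the Riemann tensor. Lowering the index
    turns it into a pairing with normal components. *)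
Lemma partial_tangent_coord i x : U x ->
  (partial i C x + tangent_coord ('J F x) *m partial i J x *m
    tangent_coord ('J F x))
    *m gram ('J F x) = normal_mx ('J F x) *m (partial i J x)^L.
Proof.
move=> Ux.
have sC := smooth_on_tangent_coord Uo smooth_on_jacobian uF.
have dC := smooth_on_derivable (v := delta_mx 0 i) sC Ux.
have dg := smooth_on_derivable (v := delta_mx 0 i) smooth_on_gram_jacobian Ux.
have eC : partial i C x *m gram ('J F x) + tangent_coord ('J F x) *m
  partial i g x
    = (partial i J x)^L.
  rewrite -[LHS](derive_mulmx dC dg).
  have -> : 'D_(delta_mx 0 i) (fun y => tangent_coord ('J F y) *m gram ('J F y))
    x
      = partial i (fun y => 1%:M *m ('J F y)^L) x.
    apply: derive_congr Uo Ux _ => y Uy /=.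
    by rewrite (tangent_coordK (uF Uy)) mul1mx.
  have s1 : smooth_on U (fun _ : 'rV[R]_n => 1%:M : 'M[R]_(2 * n)).
    exact: smooth_on_cst.
  rewrite (partial_lorentz Uo i Ux s1 smooth_on_jacobian).
  by rewrite [partial i _ x]derive_cst mul0mx add0r mul1mx.
rewrite mulmxDl -[X in _ + X]mulmxA (tangent_coordK (uF Ux)).
have -> : partial i C x *m gram ('J F x) =
    (partial i J x)^L - tangent_coord ('J F x) *m partial i g x.
  by rewrite -eC addrK.
rewrite (partial_gram_jacobian i Ux) /normal_mx.
move: (tangent_coord ('J F x)) (partial i J x) ('J F x) => T D Jx.
by rewrite mulmxDr mulmxBl mul1mx -!mulmxA opprD addrA addrAC subrK.
Qed.

(** The Gauss equation of a flat metric: the pairings of the normal components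
    of second derivatives are symmetric in i and j. *)
Lemma gauss_equation x : U x -> (forall l k i j, riemann g l k i j x = 0) ->
  forall i j k, partial2 j k x *m normal_mx ('J F x) *m (partial i J x)^L =
    partial2 i k x *m normal_mx ('J F x) *m (partial j J x)^L.
Proof.
move=> Ux flat i j k.
have sC := smooth_on_tangent_coord Uo smooth_on_jacobian uF.
have sF2 a b : smooth_on U (partial2 a b) by do 2!apply: smooth_on_partial.
have dchr a b l : partial a (christoffel g l b k) x =
    (partial a (partial2 b k) x *m C x + partial2 b k x *m partial a C x) 0 l.
  have dC := smooth_on_derivable (v := delta_mx 0 a) sC Ux.
  have dF2 := smooth_on_derivable (v := delta_mx 0 a) (sF2 b k) Ux.
  have D : partial a (fun y => partial2 b k y *m C y) x =
    partial a (partial2 b k) x *m C x + partial2 b k x *m partial a C x.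
    exact: derive_mulmx dF2 dC.
  have dFC := smooth_on_derivable (v := delta_mx 0 a)
    (smooth_on_mulmx Uo (sF2 b k) sC) Ux.
  transitivity (partial a (fun y => partial2 b k y *m C y) x 0 l); last first.
    by have /(congr1 (fun z : 'rV[R]_n => z 0 l)) := D.
  rewrite /partial (derive_mx dFC) mxE; apply: derive_congr Uo Ux _ => y Uy.
  exact: christoffelE.
have quad a b l : \sum_m christoffel g l a m x * christoffel g m b k x =
    (partial2 b k x *m C x *m partial a J x *m C x) 0 l.
  rewrite -[_ *m C x *m _ *m _]mulmxA mxE; apply: eq_bigr => m _.
  rewrite !christoffelE// mulrC; congr (_ * _).
  by rewrite -(row_partial_jacobian a m Ux) -row_mul mxE.
(* The two sides differ by a component of the Riemann tensor. *)
have curv0 : partial2 j k x *m (partial i C x + C x *m partial i J x *m C x) =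
    partial2 i k x *m (partial j C x + C x *m partial j J x *m C x).
  apply/rowP => l; apply/eqP; rewrite -subr_eq0; apply/eqP.
  have swap : partial i (partial2 j k) x = partial j (partial2 i k) x.
    exact: derive_comm Uo (smooth_on_partial k sF) Ux.
  have := flat l k i j.
  rewrite /riemann (dchr i j l) (dchr j i l) big_split /=
    sumrN (quad i j l) (quad j i l).
  rewrite swap.
  move: (partial j (partial2 i k) x) (partial2 j k x) (partial2 i k x).
  move: (partial i C x) (partial j C x) (partial i J x) (partial j J x).
  move: (tangent_coord _) => T DiC DjC Di Dj P2 p q.
  have addE (X Y : 'rV[R]_n) : (X + Y) 0 l = X 0 l + Y 0 l by rewrite mxE.
  have oppE (X : 'rV[R]_n) : (- X) 0 l = - X 0 l by rewrite mxE.
  rewrite [in X in _ -> X]mulmxDr [in X in _ -> X]mulmxDr !mulmxA.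
  by rewrite !(addE, oppE) => <-; ring.
move: curv0 (partial_tangent_coord i Ux) (partial_tangent_coord j Ux).
move: (partial i C x) (partial j C x) (partial i J x) (partial j J x).
move: (partial2 j k x) (partial2 i k x) => p q DiC DjC Di Dj curv0 ei ej.
by rewrite -[LHS]mulmxA -[RHS]mulmxA -ei -ej [LHS]mulmxA [RHS]mulmxA curv0.
Qed.

End Gauss.

(** * The trace of the Gauss equation *)

Section HCommute.
Context (R : realType) (n : nat) (h : 'M[R]_n).

(** M and N are matrices of bilinear forms and h is the inverse of the Gram
    matrix of a metric. When h is invertible, this says that the endomorphisms
    M h and N h associated to these forms by the metric commute. *)
Definition hcommute (M N : 'M[R]_n) := M *m h *m N = N *m h *m M.

Lemma hcommute_sym M N : hcommute M N -> hcommute N M.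
Proof. by []. Qed.

Lemma hcommuteD M N N' : hcommute M N -> hcommute M N' -> hcommute M (N + N').
Proof. by rewrite /hcommute !mulmxDl !mulmxDr => -> ->. Qed.

Lemma hcommuteZ M N a : hcommute M N -> hcommute M (a *: N).
Proof. by rewrite /hcommute -!scalemxAl -!scalemxAr => ->. Qed.

Lemma hcommute_sum I (r : seq I) M (N : I -> 'M[R]_n) :
  (forall i, hcommute M (N i)) -> hcommute M (\sum_(i <- r) N i).
Proof.
move=> cN; elim/big_rec: _ => [|i N' _ cN'].
  by rewrite /hcommute !mul0mx mulmx0.
exact: hcommuteD.
Qed.

Variable g : 'M[R]_n.
Hypotheses (gh : g *m h = 1%:M) (gT : g^T = g) (hT : h^T = h).

Lemma hcommute_metric M : hcommute M g.
Proof. by rewrite /hcommute gh mul1mx -mulmxA (mulmx1C gh) mulmx1. Qed.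

(** T j k i p stands for the product of the values at (j, k) and at (i, p) of
    a vector-valued symmetric form. If T and c satisfy the Gauss equation of a
    flat metric g, and if W commutes with all T j k, then W commutes with c.
    Contracting the Gauss equation with h = g^-1 in the indices i and p gives
    (n - 2) c = E - t g - Q, where E is the contraction of the T i p, t is the
    trace of c, and Q j k is the contraction of T i k j p. *)
Lemma hcommute_gauss_trace (c W : 'M[R]_n) (T : 'I_n -> 'I_n -> 'M[R]_n) :
  (2 < n)%N ->
  (forall j k i p, T j k i p = T i p j k) ->
  (forall j k, hcommute W (T j k)) ->
  (forall j k i p, T j k i p - g j k * c i p - c j k * g i p =
                   T i k j p - g i k * c j p - c i k * g j p) ->
  hcommute W c.
Proof.
move=> n2 Tp TW gauss.
have gE i j : g i j = g j i by rewrite -{1}gT mxE.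
have hE i j : h i j = h j i by rewrite -{1}hT mxE.
pose E := \sum_i \sum_p h i p *: T i p.
pose Q := \matrix_(j, k) \sum_i \sum_p h i p * T i k j p.
pose t := \sum_i \sum_p h i p * c i p.
have cE : hcommute W E.
  apply: hcommute_sum => i; apply: hcommute_sum => p.
  exact: hcommuteZ.
have cQ : hcommute W Q.
  apply/esym/matrixP => j l.
  (* As W commutes with the T j k, the (j, l) entries of Q h W and of W h Q are
     both the contraction of T j k m l with h W h in k and m. *)
  pose H := h *m W *m h.
  transitivity (\sum_k \sum_m H k m * T j k m l).
    rewrite -mulmxA mxE.
    transitivity (\sum_k \sum_i \sum_p h i p * (T j p i k * (h *m W) k l)).
      apply: eq_bigr => k _; rewrite mxE mulr_suml; apply: eq_bigr => i _.
      by rewrite mulr_suml; apply: eq_bigr => p _; rewrite Tp mulrA.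
    rewrite exchange_big.
    transitivity (\sum_i \sum_p h i p * (W *m h *m T j p) i l).
      apply: eq_bigr => i _; rewrite exchange_big; apply: eq_bigr => p _.
      by rewrite TW -mulmxA mxE mulr_sumr.
    rewrite exchange_big; apply: eq_bigr => p _.
    under eq_bigr => i _ do rewrite mxE mulr_sumr.
    rewrite exchange_big; apply: eq_bigr => m _.
    rewrite /H -mulmxA [in RHS]mxE mulr_suml; apply: eq_bigr => i _.
    by rewrite hE mulrA.
  rewrite mxE.
  transitivity (\sum_a \sum_i \sum_p h i p * ((W *m h) j a * T i l a p)).
    rewrite [RHS]exchange_big /=.
    transitivity (\sum_i \sum_p h i p * (T i l *m h *m W) j p).
      rewrite exchange_big; apply: eq_bigr => i _.
      transitivity (\sum_k T i l j k * H k i).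
        by apply: eq_bigr => k _; rewrite Tp mulrC.
      under [RHS]eq_bigr => p _ do rewrite -mulmxA mxE mulr_sumr.
      rewrite exchange_big; apply: eq_bigr => k _.
      rewrite /H mxE mulr_sumr; apply: eq_bigr => p _.
      by rewrite mulrCA hE; ring.
    apply: eq_bigr => i _; rewrite [RHS]exchange_big; apply: eq_bigr => p _.
    by rewrite -TW mxE mulr_sumr.
  apply: eq_bigr => a _; rewrite [Q a l]mxE mulr_sumr; apply: eq_bigr => i _.
  by rewrite mulr_sumr; apply: eq_bigr => p _; rewrite mulrCA.
have c_eq : (n%:R - 2) *: c = E + (- t) *: g + (-1) *: Q.
  apply/matrixP => j k.
  have : \sum_i \sum_p h i p * (T j k i p - g j k * c i p - c j k * g i p) =
         \sum_i \sum_p h i p * (T i k j p - g i k * c j p - c i k * g j p).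
    by apply: eq_bigr => i _; apply: eq_bigr => p _; rewrite gauss.
  have splitE (f1 f2 f3 : 'I_n -> 'I_n -> R) :
     \sum_i \sum_p h i p * (f1 i p - f2 i p - f3 i p) =
     \sum_i \sum_p h i p * f1 i p - \sum_i \sum_p h i p * f2 i p
     - \sum_i \sum_p h i p * f3 i p.
    rewrite -!sumrB; apply: eq_bigr => i _.
    by rewrite -!sumrB; apply: eq_bigr => p _; rewrite !mulrBr.
  rewrite !splitE.
  have -> : \sum_i \sum_p h i p * T j k i p = E j k.
    rewrite summxE; apply: eq_bigr => i _; rewrite summxE;
      apply: eq_bigr => p _.
    by rewrite mxE Tp.
  have -> : \sum_i \sum_p h i p * (g j k * c i p) = g j k * t.
    rewrite mulr_sumr; apply: eq_bigr => i _.
    by rewrite mulr_sumr; apply: eq_bigr => p _; rewrite mulrCA.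
  have -> : \sum_i \sum_p h i p * (c j k * g i p) = c j k * n%:R.
    have -> : n%:R = \tr (h *m g) :> R by rewrite (mulmx1C gh) mxtrace1.
    rewrite mulr_sumr; apply: eq_bigr => i _; rewrite mxE mulr_sumr.
    by apply: eq_bigr => p _; rewrite mulrCA gE.
  have -> : \sum_i \sum_p h i p * T i k j p = Q j k by rewrite mxE.
  have -> : \sum_i \sum_p h i p * (g i k * c j p) = c j k.
    rewrite -[RHS](congr1 (fun M : 'M[R]_n => M j k) (mulmx1 c)) -(mulmx1C gh).
    rewrite mulmxA mxE; apply: eq_bigr => i _; rewrite mxE mulr_suml.
    by apply: eq_bigr => p _; rewrite hE; ring.
  have -> : \sum_i \sum_p h i p * (c i k * g j p) = c j k.
    rewrite -[RHS](congr1 (fun M : 'M[R]_n => M j k) (mul1mx c)) -gh.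
    rewrite mxE; apply: eq_bigr => i _; rewrite mxE mulr_suml.
    by apply: eq_bigr => p _; rewrite hE; ring.
  have addE (X Y : 'M[R]_n) : (X + Y) j k = X j k + Y j k by rewrite mxE.
  have scaleE a (X : 'M[R]_n) : (a *: X) j k = a * X j k by rewrite mxE.
  rewrite !(addE, scaleE) => /eqP; rewrite -subr_eq0 => /eqP H.
  by apply/eqP; rewrite -subr_eq0 -oppr_eq0 -H; apply/eqP; ring.
have n20 : n%:R - 2 != 0 :> R.
  by rewrite subr_eq0 eqr_nat gtn_eqF.
have -> : c = (n%:R - 2)^-1 *: ((n%:R - 2) *: c) by rewrite scalerA mulVf//
  scale1r.
apply: hcommuteZ; rewrite c_eq; apply: hcommuteD; last exact: hcommuteZ.
by apply: hcommuteD => //; apply: hcommuteZ; exact: hcommute_metric.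
Qed.

End HCommute.

(** * Second fundamental form of an immersion into the light-cone *)

Section LorentzForm.
Context (R : realType) (n : nat).
Implicit Types u v w : 'rV[R]_(2 * n).

Lemma lorentzE u v : lorentz u v = (u *m v^L) 0 0.
Proof. by rewrite /lorentz mulmxA. Qed.

Lemma lorentzC u v : lorentz u v = lorentz v u.
Proof. by rewrite !lorentzE -lorentz_adjoint mxE. Qed.

Lemma lorentzDl u v w : lorentz (u + v) w = lorentz u w + lorentz v w.
Proof. by rewrite /lorentz !mulmxDl mxE. Qed.

Lemma lorentzZl a u v : lorentz (a *: u) v = a * lorentz u v.
Proof. by rewrite /lorentz -!scalemxAl mxE. Qed.

Lemma lorentzNl u v : lorentz (- u) v = - lorentz u v.
Proof. by rewrite -scaleN1r lorentzZl mulN1r. Qed.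

Lemma lorentzDr u v w : lorentz u (v + w) = lorentz u v + lorentz u w.
Proof. by rewrite !(lorentzC u) lorentzDl. Qed.

Lemma lorentzZr a u v : lorentz u (a *: v) = a * lorentz u v.
Proof. by rewrite !(lorentzC u) lorentzZl. Qed.

Lemma lorentzNr u v : lorentz u (- v) = - lorentz u v.
Proof. by rewrite !(lorentzC u) lorentzNl. Qed.

Lemma lorentz_comb x u v w b c :
  lorentz x (u + b *: v + c *: w) = lorentz x u + b * lorentz x v +
    c * lorentz x w.
Proof. by rewrite !lorentzDr !lorentzZr. Qed.

(** Rewriting rules that expand the form by bilinearity. *)
Definition lorentz_bilinear :=
  (lorentzDl, lorentzZl, lorentzNl, lorentzDr, lorentzZr, lorentzNr).

Lemma lorentz_scalar_mx u v : u *m v^L = (lorentz u v)%:M.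
Proof. by rewrite [LHS]mx11_scalar lorentzE. Qed.

Lemma lorentz_row p (A : 'M[R]_(p, 2 * n)) v i :
  (A *m v^L) i 0 = lorentz (row i A) v.
Proof. by rewrite lorentzE -row_mul [in RHS]mxE. Qed.

Lemma orthogonal_rowsP p (A : 'M[R]_(p, 2 * n)) v :
  A *m v^L = 0 <-> forall i, lorentz (row i A) v = 0.
Proof.
split=> [Av i|Av]; first by rewrite -lorentz_row Av mxE.
by apply/colP => i; rewrite lorentz_row Av mxE.
Qed.

Lemma lorentz_normal_mx p (A : 'M[R]_(p, 2 * n)) u v :
  lorentz (u *m normal_mx A) v = lorentz u (v *m normal_mx A).
Proof. by rewrite !lorentzE -mulmx_normalL [in RHS]mulmxA. Qed.

End LorentzForm.

Section SecondFundamentalForm.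
Context (R : realType) (n : nat).
(* The rows of J are first derivatives; the rows of [D j] are the derivatives of
   the rows of J in direction j. *)
Variables (J : 'M[R]_(n, 2 * n)) (D : 'I_n -> 'M[R]_(n, 2 * n)).
Local Notation g := (gram J).
Local Notation h := (invmx (gram J)).

(** The second fundamental form in the direction of the normal vector v: the
    matrix of the products of v with the second derivatives. *)
Definition second_form (v : 'rV[R]_(2 * n)) : 'M[R]_n :=
  \matrix_(j, k) lorentz (row k (D j)) v.

Lemma second_formD u v : second_form (u + v) = second_form u + second_form v.
Proof. by apply/matrixP => j k; rewrite !mxE lorentzDr. Qed.

Lemma second_formZ a v : second_form (a *: v) = a *: second_form v.
Proof. by apply/matrixP => j k; rewrite !mxE lorentzZr. Qed.

Lemma second_form_comb u v w b c :
  second_form (u + b *: v + c *: w) = second_form u + b *: second_form v + c *: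
    second_form w.
Proof. by rewrite !second_formD !second_formZ. Qed.

Hypothesis Dsym : forall j k, row k (D j) = row j (D k).

Lemma trmx_second_form v : (second_form v)^T = second_form v.
Proof. by apply/matrixP => j k; rewrite !mxE Dsym. Qed.

Lemma second_form_rowl v j : v *m (D j)^L = row j (second_form v).
Proof.
by apply/rowP => k; rewrite -lorentz_adjoint !mxE -lorentz_row mxE.
Qed.

Lemma second_form_colr v j : D j *m v^L = col j (second_form v).
Proof. by apply/colP => k; rewrite lorentz_row !mxE Dsym. Qed.

(** The commutation condition of the Ricci equation, for the frame of first
    derivatives, in terms of the matrices of the second fundamental forms. *)
Lemma hcommute_second_formP (K : 'M[R]_n) v w :
  K^T = K ->
  (forall i j, v *m (D j)^L *m K *m (D i *m w^L) = v *m (D i)^L *m K *m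
    (D j *m w^L))
  <-> hcommute K (second_form v) (second_form w).
Proof.
move=> KT.
have E i j : (v *m (D j)^L *m K *m (D i *m w^L)) 0 0 =
    (second_form v *m K *m second_form w) j i.
  by rewrite second_form_rowl second_form_colr -row_mul colE mulmxA -colE
    -row_mul !mxE.
have S i j : (second_form v *m K *m second_form w) j i =
    (second_form w *m K *m second_form v) i j.
  transitivity ((second_form v *m K *m second_form w)^T i j).
    by rewrite [RHS]mxE.
  by rewrite !trmx_mul !trmx_second_form KT mulmxA.
split=> [H|H i j].
  by apply/matrixP => j i; rewrite -E H E S.
by rewrite [LHS]mx11_scalar [RHS]mx11_scalar !E S H.
Qed.

Variables (P t0 : 'rV[R]_(2 * n)).
Hypotheses (uJ : g \in unitmx) (JP : J *m P^L = 0) (PP : lorentz P P = 0).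
Hypothesis second_form_position : second_form P = - g.
Hypothesis t0P : lorentz t0 P != 0.
Hypothesis gauss : forall i j k,
  row k (D j) *m normal_mx J *m (D i)^L = row k (D i) *m normal_mx J *m (D j)^L.

(** With J the derivative and P the value of a spherical map, or of its lift
    to the light-cone, these are the vectors normal to the spherical map in
    the sphere. *)
Definition sphere_normal v :=
  [/\ J *m v^L = 0, lorentz P v = 0 & lorentz t0 v = 0].

Hypothesis sphere_flat : forall v w, sphere_normal v -> sphere_normal w ->
  hcommute h (second_form v) (second_form w).
Hypothesis dim : (2 < n)%N \/ forall v, sphere_normal v -> v = 0.

Let mu := lorentz t0 P.
Let a := - (2 * mu ^+ 2)^-1 * lorentz t0 (t0 *m normal_mx J).
(* The null normal vector with product 1 with P that is orthogonal to all
   [sphere_normal] vectors; the coefficient a makes it null. *)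
Let Z := mu^-1 *: (t0 *m normal_mx J) + a *: P.

Let P_normal : P *m normal_mx J = P.
Proof. exact/normal_mx_id/lorentz_orthC. Qed.

Let lorentz_t0n v : J *m v^L = 0 -> lorentz (t0 *m normal_mx J) v =
  lorentz t0 v.
Proof. by move=> Jv; rewrite lorentz_normal_mx normal_mx_id//;
  exact: lorentz_orthC. Qed.

Let JZ : J *m Z^L = 0.
Proof.
apply: lorentz_orthC; rewrite mulmxDl -!scalemxAl normal_mx_orth//
  scaler0 add0r.
by rewrite (lorentz_orthC JP) scaler0.
Qed.

Let lorentz_Z v : J *m v^L = 0 ->
  lorentz v Z = mu^-1 * lorentz t0 v + a * lorentz P v.
Proof.
move=> Jv; rewrite !lorentz_bilinear (lorentzC v) lorentz_t0n//.
by rewrite (lorentzC v).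
Qed.

Let PZ : lorentz P Z = 1.
Proof. by rewrite lorentz_Z// PP mulr0 addr0 mulVf. Qed.

Let t0Z : lorentz t0 Z = - a * mu.
Proof.
rewrite !lorentz_bilinear /a -/mu; set s := lorentz _ (_ *m _).
by have mu0 : mu != 0 by []; field.
Qed.

(** Every vector normal to J is the sum of a vector normal to the spherical map
    and of a combination of Z and P. *)
Lemma sphere_normal_part v : J *m v^L = 0 ->
  sphere_normal (v + (- lorentz P v) *: Z + (- lorentz Z v) *: P).
Proof.
move=> Jv; have Jv' : J *m (v + (- lorentz P v) *: Z + (- lorentz Z v) *: P)^L =
  0.
  apply: lorentz_orthC; rewrite !mulmxDl -!scalemxAl.
  by rewrite (lorentz_orthC Jv) (lorentz_orthC JZ) (lorentz_orthC JP) !scaler0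
    !addr0.
split=> //; rewrite lorentz_comb.
  by rewrite PZ PP; ring.
rewrite t0Z -/mu (lorentzC Z) lorentz_Z//.
by have mu0 : mu != 0 by []; field.
Qed.

(** The shape operators of a flat immersion into the light-cone commute as
    soon as those of the normal vectors orthogonal to its position P and to t0
    do. *)
Lemma second_form_hcommute v w : J *m v^L = 0 -> J *m w^L = 0 ->
  hcommute h (second_form v) (second_form w).
Proof.
have gh : g *m h = 1%:M by rewrite mulmxV.
have gT := trmx_gram J.
have hT : h^T = h by rewrite trmx_inv gT.
have cZ u : sphere_normal u -> hcommute h (second_form u) (second_form Z).
  move=> nu; case: dim => [n2|/(_ _ nu) ->]; last first.
    suff -> : second_form 0 = 0 by rewrite /hcommute !mul0mx !mulmx0.
    by rewrite -(scale0r 0) second_formZ scale0r.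
  (* q is the vector-valued second fundamental form, and tau is its component
     normal to the spherical map. *)
  pose q j k := row k (D j) *m normal_mx J.
  pose tau j k := q j k + g j k *: Z + (- second_form Z j k) *: P.
  have uP j k : lorentz (row k (D j)) P = - g j k.
    by have /matrixP/(_ j k) := second_form_position; rewrite !mxE.
  have uZ j k : lorentz (row k (D j)) Z = second_form Z j k by rewrite mxE.
  have Jq j k : J *m (q j k)^L = 0 by exact/lorentz_orthC/normal_mx_orth.
  have Pq j k : lorentz P (q j k) = - g j k.
    by rewrite -lorentz_normal_mx P_normal lorentzC uP.
  have t0q j k : lorentz t0 (q j k) = mu * (second_form Z j k + a * g j k).
    have := lorentz_Z (Jq j k); rewrite Pq.
    rewrite lorentz_normal_mx normal_mx_id ?uZ; last exact: lorentz_orthC.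
    by move=> ->; have mu0 : mu != 0 by []; field.
  have tau_normal j k : sphere_normal (tau j k).
    split; last 2 first.
    - by rewrite lorentz_comb Pq PZ PP; ring.
    - by rewrite lorentz_comb t0q t0Z -/mu; ring.
    apply: lorentz_orthC; rewrite !mulmxDl -!scalemxAl (lorentz_orthC (Jq j k)).
    by rewrite (lorentz_orthC JZ) (lorentz_orthC JP) !scaler0 !addr0.
  have tauE j k i p : second_form (tau j k) i p = lorentz (row p (D i)) (q j k)
      + g j k * second_form Z i p + second_form Z j k * g i p.
    by rewrite mxE lorentz_comb uP uZ; ring.
  apply: (hcommute_gauss_trace gh gT hT (T := fun j k => second_form (tau j k)))
    => //.
  - move=> j k i p; rewrite !tauE -lorentz_normal_mx lorentzC -/(q i p).
    by ring.
  - by move=> j k; exact: sphere_flat.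
  - have gE i p : g i p = g p i by rewrite -{1}gT mxE.
    have ZE i p : second_form Z i p = second_form Z p i.
      by rewrite -{1}trmx_second_form mxE.
    have qE j k i p : lorentz (row p (D i)) (q j k) =
      lorentz (row p (D j)) (q i k).
      have /matrixP/(_ 0 p) := gauss i j k.
      by rewrite -!(lorentz_adjoint (D _)) [LHS]mxE [RHS]mxE !lorentz_row.
    by move=> j k i p; rewrite !tauE (qE j k i p); ring.
have decomp u : J *m u^L = 0 -> exists u' b c, sphere_normal u' /\
    second_form u = second_form u' + b *: second_form Z + c *: g.
  move=> Ju; exists (u + (- lorentz P u) *: Z + (- lorentz Z u) *: P).
  exists (lorentz P u), (- lorentz Z u); split; first exact: sphere_normal_part.
  rewrite second_form_comb second_form_position.
  move: (lorentz P u) (lorentz Z u) (second_form u) (second_form Z) (gram J) =>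
    b c M N G.
  by apply/matrixP => i j; rewrite !mxE; ring.
move=> /decomp[v' [b [c [nv ->]]]] /decomp[w' [b' [c' [nw ->]]]].
have cg M := hcommute_metric gh M.
apply: hcommuteD; last exact/hcommuteZ/cg.
apply: hcommute_sym; apply: hcommuteD; last exact/hcommuteZ/cg.
apply: hcommuteD.
  apply: hcommute_sym; apply: hcommuteD; first exact: sphere_flat.
  exact/hcommuteZ/cZ.
apply: hcommuteZ; apply: hcommute_sym; apply: hcommuteD; last exact: hcommuteZ.
exact/hcommute_sym/cZ.
Qed.

End SecondFundamentalForm.

(** * Rescaling a spherical map to the light-cone *)

Section LorentzDerivative.
Context (R : realType) (n : nat) (U : set 'rV[R]_n).
Hypothesis Uo : open U.

Lemma smooth_on_lorentz (F G : 'rV[R]_n -> 'rV[R]_(2 * n)) :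
  smooth_on U F -> smooth_on U G -> smooth_on U (fun y => lorentz (F y) (G y)).
Proof.
move=> sF sG.
have sFG : smooth_on U (fun y => F y *m lorentz_mx R n *m (G y)^T).
  apply: smooth_on_mulmx => //; last exact: smooth_on_trmx.
  by apply: smooth_on_mulmx => //; exact: smooth_on_cst.
exact: (smooth_on_mxP _ Uo).1 sFG 0 0.
Qed.

Lemma partial_lorentz_form (F G : 'rV[R]_n -> 'rV[R]_(2 * n)) i x : U x ->
  smooth_on U F -> smooth_on U G ->
  partial i (fun y => lorentz (F y) (G y)) x =
    lorentz (partial i F x) (G x) + lorentz (F x) (partial i G x).
Proof.
move=> Ux sF sG.
have := partial_lorentz Uo i Ux sF sG.
have sFG : smooth_on U (fun y => F y *m (G y)^L).
  apply: smooth_on_mulmx => //; apply: smooth_on_mulmx => //.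
    exact: smooth_on_cst.
  exact: smooth_on_trmx.
have dFG := smooth_on_derivable (v := delta_mx 0 i) sFG Ux.
rewrite {1}/partial (derive_mx dFG) => /matrixP /(_ 0 0).
rewrite mxE [RHS]mxE -!lorentzE => <-.
by apply: derive_congr Uo Ux _ => y _; rewrite lorentzE.
Qed.

Lemma partial_cst (W : normedModType R) (w : W) i x :
  partial i (fun _ : 'rV[R]_n => w) x = 0.
Proof. exact: derive_cst. Qed.

End LorentzDerivative.

Lemma gram_entry (R : realType) n k (A : 'M[R]_(k, 2 * n)) i j :
  gram A i j = lorentz (row i A) (row j A).
Proof. by rewrite -lorentz_row tr_row colE !mulmxA -colE [RHS]mxE. Qed.

Lemma gram_col_mx (R : realType) n k l (A : 'M[R]_(k, 2 * n))
  (B : 'M[R]_(l, 2 * n)) :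
  A *m B^L = 0 -> gram (col_mx A B) = block_mx (gram A) 0 0 (gram B).
Proof.
move=> AB; have BA := lorentz_orthC AB.
by rewrite !gramE tr_col_mx mul_mx_row mul_col_row AB BA.
Qed.

(* Here l and dl are the value and the partial derivatives of the scaling
   factor, f is the value of the spherical map, and J and J' are the
   derivatives of the spherical map and of its lift. *)
Section ConformalFrame.
Context (R : realType) (n : nat).
Variables (J J' : 'M[R]_(n, 2 * n)) (f t0 : 'rV[R]_(2 * n)) (l : R)
  (dl : 'I_n -> R).
Hypothesis J'E : forall i, row i J' = dl i *: (f + t0) + l *: row i J.
Hypothesis l0 : l != 0.

Lemma sphere_normal_conformal v :
  sphere_normal J' (l *: (f + t0)) t0 v <-> sphere_normal J f t0 v.
Proof.
have PE : lorentz (l *: (f + t0)) v = l * (lorentz f v + lorentz t0 v).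
  by rewrite lorentzZl lorentzDl.
have rowE' i : lorentz (row i J') v =
    dl i * (lorentz f v + lorentz t0 v) + l * lorentz (row i J) v.
  by rewrite J'E lorentzDl !lorentzZl lorentzDl.
split=> -[/orthogonal_rowsP Jv Pv tv].
  have pv : lorentz f v = 0.
    move: Pv; rewrite PE tv addr0 => /eqP.
    by rewrite mulf_eq0 (negPf l0) /= => /eqP.
  split=> //; apply/orthogonal_rowsP => i.
  have := Jv i; rewrite rowE' pv tv addr0 mulr0 add0r => /eqP.
  by rewrite mulf_eq0 (negPf l0) /= => /eqP.
split=> //; last by rewrite PE Pv tv addr0 mulr0.
by apply/orthogonal_rowsP => i; rewrite rowE' Jv Pv tv addr0 !mulr0 addr0.
Qed.

Lemma gram_conformal : lorentz (f + t0) (f + t0) = 0 ->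
  (forall i, lorentz (row i J) (f + t0) = 0) -> gram J' = l ^+ 2 *: gram J.
Proof.
move=> zz zd; apply/matrixP => i j; rewrite [RHS]mxE !gram_entry !J'E.
rewrite lorentzDl !lorentzDr !lorentzZl !lorentzZr zz zd.
by rewrite (lorentzC (f + t0)) zd; ring.
Qed.

Lemma second_form_conformal (D D' : 'I_n -> 'M[R]_(n, 2 * n))
    (ddl : 'I_n -> 'I_n -> R) v :
  (forall i j, row j (D' i) = ddl i j *: (f + t0) + dl j *: row i J
     + (dl i *: row j J + l *: row j (D i))) ->
  sphere_normal J f t0 v -> second_form D' v = l *: second_form D v.
Proof.
move=> D'E [/orthogonal_rowsP Jv fv tv]; apply/matrixP => i j; rewrite !mxE D'E.
by rewrite !lorentzDl !lorentzZl lorentzDl fv tv !Jv; ring.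
Qed.

End ConformalFrame.

Section ConformalChange.
Context (R : realType) (n : nat) (U : set 'rV[R]_n).
Variables (t0 : 'rV[R]_(2 * n)) (phi : 'rV[R]_n -> 'rV[R]_(2 * n)).
Variable lam : 'rV[R]_n -> R.
Hypotheses (Uo : open U) (sphi : smooth_on U phi) (slam : smooth_on U lam).
Hypothesis lam0 : forall x, U x -> lam x != 0.
Hypothesis t0t0 : lorentz t0 t0 = -1.
Hypothesis phi_sphere : forall x, U x -> unit_sphere t0 (phi x).

Let Phi y := lam y *: (phi y + t0).
Let Jphi y := 'J phi y.
Let JPhi y := 'J Phi y.

Let sphit : smooth_on U (fun y => phi y + t0).
Proof. by apply: smooth_onD => //; exact: smooth_on_cst. Qed.

Lemma smooth_on_lift : smooth_on U Phi.
Proof. exact: smooth_onZ. Qed.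

Let sPhi := smooth_on_lift.

Lemma lorentz_lift x : U x -> lorentz (Phi x) (Phi x) = 0.
Proof.
move=> Ux; have [pt pp] := phi_sphere Ux.
rewrite lorentzZl lorentzZr lorentzDl !lorentzDr pp pt lorentzC pt t0t0; ring.
Qed.

Let lorentz0r v : lorentz v (0 : 'rV[R]_(2 * n)) = 0.
Proof. by rewrite -(scale0r (0 : 'rV[R]_(2 * n))) lorentzZr mul0r. Qed.

Lemma partial_phi_t0 i x : U x -> lorentz (partial i phi x) t0 = 0.
Proof.
move=> Ux.
have st : smooth_on U (fun _ : 'rV[R]_n => t0) by exact: smooth_on_cst.
have := partial_lorentz_form Uo i Ux sphi st.
rewrite (partial_cst t0) lorentz0r addr0 => <-.
rewrite -[RHS](partial_cst (0 : R) i x); apply: derive_congr Uo Ux _ => y Uy.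
by have [] := phi_sphere Uy.
Qed.

Lemma partial_phi_phi i x : U x -> lorentz (partial i phi x) (phi x) = 0.
Proof.
move=> Ux.
have H : partial i (fun y => lorentz (phi y) (phi y)) x = 0.
  rewrite -[RHS](partial_cst (1 : R) i x); apply: derive_congr Uo Ux _ => y Uy.
  by have [] := phi_sphere Uy.
move: H; rewrite (partial_lorentz_form Uo i Ux sphi sphi) (lorentzC (phi x)) =>
  H.
lra.
Qed.

Let dphit x i : U x -> partial i (fun y => phi y + t0) x = partial i phi x.
Proof.
move=> Ux; have dp := smooth_on_derivable (v := delta_mx 0 i) sphi Ux.
have := deriveD dp (derivable_cst t0 x (delta_mx 0 i)).
by rewrite derive_cst addr0.
Qed.

Lemma partial_lift i x : U x ->
  partial i Phi x = partial i lam x *: (phi x + t0) + lam x *: partial i phi x.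
Proof.
move=> Ux; have dl := smooth_on_derivable (v := delta_mx 0 i) slam Ux.
have dp := smooth_on_derivable (v := delta_mx 0 i) sphit Ux.
have := derive_scalemx dl dp.
by have := dphit i Ux; rewrite /partial => ->.
Qed.

Lemma partial2_lift i j x : U x ->
  partial i (partial j Phi) x =
    partial i (partial j lam) x *: (phi x + t0) + partial j lam x *:
      partial i phi x
    + (partial i lam x *: partial j phi x + lam x *:
      partial i (partial j phi) x).
Proof.
move=> Ux.
have sl := smooth_on_partial j slam; have sp := smooth_on_partial j sphi.
have s1 := smooth_onZ Uo sl sphit; have s2 := smooth_onZ Uo slam sp.
pose e : 'rV[R]_n := delta_mx 0 i.
have dl := smooth_on_derivable (v := e) sl Ux.
have dp := smooth_on_derivable (v := e) sp Ux.
have dl' := smooth_on_derivable (v := e) slam Ux.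
have dp' := smooth_on_derivable (v := e) sphit Ux.
have d1 := derive_scalemx dl dp'; have d2 := derive_scalemx dl' dp.
have d12 := deriveD (smooth_on_derivable (v := e) s1 Ux)
  (smooth_on_derivable (v := e) s2 Ux).
rewrite d1 d2 in d12.
rewrite -(dphit i Ux); apply: etrans d12.
by apply: derive_congr Uo Ux _ => y Uy; exact: partial_lift.
Qed.

Let row_Jphi x i : U x -> row i (Jphi x) = partial i phi x.
Proof. by move=> Ux; exact: row_jacobian sphi _ _ Ux. Qed.

Let row_JPhi x i : U x ->
  row i (JPhi x) = partial i lam x *: (phi x + t0) + lam x *: row i (Jphi x).
Proof.
move=> Ux; apply: etrans (row_jacobian sPhi i Ux) _.
apply: etrans (partial_lift i Ux) _.
by have -> := row_Jphi i Ux.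
Qed.

(** The lift and phi have the same normal vectors that are orthogonal to both
    phi and t0. *)
Lemma sphere_normal_lift x v : U x ->
  sphere_normal (JPhi x) (Phi x) t0 v <-> sphere_normal (Jphi x) (phi x) t0 v.
Proof.
move=> Ux.
exact: (sphere_normal_conformal (fun i => row_JPhi i Ux) (lam0 Ux)).
Qed.

(** The induced metric of the lift is conformal to the one of phi, because
    phi + t0 is null and orthogonal to the derivatives of phi. *)
Lemma gram_lift x : U x -> gram (JPhi x) = lam x ^+ 2 *: gram (Jphi x).
Proof.
move=> Ux; have [pt pp] := phi_sphere Ux.
apply: (gram_conformal (fun i => row_JPhi i Ux)).
  by rewrite lorentzDl !lorentzDr pp pt lorentzC pt t0t0; ring.
by move=> i; rewrite row_Jphi// lorentzDr partial_phi_phi// partial_phi_t0//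
  addr0.
Qed.

Let Dphi x j := partial j Jphi x.
Let DPhi x j := partial j JPhi x.

Lemma second_form_lift x v : U x -> sphere_normal (Jphi x) (phi x) t0 v ->
  second_form (DPhi x) v = lam x *: second_form (Dphi x) v.
Proof.
move=> Ux; apply: second_form_conformal => i j.
apply: etrans (row_partial_jacobian Uo sPhi i j Ux) _.
apply: etrans (partial2_lift i j Ux) _.
have -> := row_Jphi i Ux; have -> := row_Jphi j Ux.
by have -> := row_partial_jacobian Uo sphi i j Ux.
Qed.

End ConformalChange.

(** * The Ricci equation in terms of second fundamental forms *)

Section TangentFrame.
Context (R : realType) (n : nat) (U : set 'rV[R]_n).
Variable F : 'rV[R]_n -> 'rV[R]_(2 * n).
Hypotheses (Uo : open U) (sF : smooth_on U F).
Local Notation J := (fun y => 'J F y).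

Lemma row_partial_jacobian_comm i j x : U x ->
  row j (partial i J x) = row i (partial j J x).
Proof.
move=> Ux; apply: etrans (row_partial_jacobian Uo sF i j Ux) _.
apply: etrans (partial2_comm Uo sF i j Ux) _.
exact/esym/(row_partial_jacobian Uo sF j i Ux).
Qed.

Lemma trmx_invmx_gram k (B : 'M[R]_(k, 2 * n)) : (invmx (gram B))^T =
  invmx (gram B).
Proof. by rewrite trmx_inv trmx_gram. Qed.

Lemma tangent_shapeP x : U x ->
  shape_operators_commute J x <->
  forall v w, 'J F x *m v^L = 0 -> 'J F x *m w^L = 0 ->
    hcommute (invmx (gram ('J F x))) (second_form (fun j => partial j J x) v)
      (second_form (fun j => partial j J x) w).
Proof.
move=> Ux; have Dsym j k := row_partial_jacobian_comm j k Ux.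
have P v w := hcommute_second_formP Dsym v w (trmx_invmx_gram ('J F x)).
split=> H v w Jv Jw; first by apply/P; exact: H.
by have /P := H v w Jv Jw.
Qed.

Variable t0 : 'rV[R]_(2 * n).
Hypothesis t0t0 : lorentz t0 t0 = -1.
Hypothesis F_sphere : forall x, U x -> unit_sphere t0 (F x).
Local Notation C := (fun y => col_mx (F y) t0).
Local Notation S := (fun y => col_mx ('J F y) (col_mx (F y) t0)).

Lemma sphere_frame_orth x v :
  S x *m v^L = 0 <-> sphere_normal ('J F x) (F x) t0 v.
Proof.
rewrite !mul_col_mx !lorentz_scalar_mx; split=> [/eqP|[-> -> ->]].
  rewrite !col_mx_eq0 => /and3P[/eqP Jv /eqP pv /eqP tv]; split=> //.
    by have /matrixP/(_ 0 0) := pv; rewrite !mxE.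
  by have /matrixP/(_ 0 0) := tv; rewrite !mxE.
by rewrite raddf0 !col_mx0.
Qed.

Lemma smooth_on_sphere_frame : smooth_on U S.
Proof.
apply: smooth_on_col_mx => //; first exact: smooth_on_jacobian.
by apply: smooth_on_col_mx => //; exact: smooth_on_cst.
Qed.

Lemma jacobian_orth_position x : U x -> 'J F x *m (C x)^L = 0.
Proof.
move=> Ux; rewrite tr_col_mx !mul_mx_row.
have -> : 'J F x *m (F x)^L = 0.
  apply/orthogonal_rowsP => i; have -> := row_jacobian sF i Ux.
  exact: partial_phi_phi Uo sF F_sphere i _ Ux.
have -> : 'J F x *m t0^L = 0.
  apply/orthogonal_rowsP => i; have -> := row_jacobian sF i Ux.
  exact: partial_phi_t0 Uo sF F_sphere i _ Ux.
by rewrite row_mx0.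
Qed.

Lemma gram_position_unit x : U x -> gram (C x) \in unitmx.
Proof.
move=> Ux; have [pt pp] := F_sphere Ux.
rewrite gram_col_mx; last by rewrite lorentz_scalar_mx pt raddf0.
rewrite !gramE !lorentz_scalar_mx pp t0t0 unitmxE det_ublock !det_scalar1.
by rewrite unitfE mul1r oppr_eq0 oner_eq0.
Qed.

(** The frame of J, F x and t0 is nondegenerate exactly when J is, because F x
    and t0 are orthonormal up to sign and orthogonal to J. *)
Lemma sphere_frame_unit x : U x ->
  (gram (S x) \in unitmx) = (gram ('J F x) \in unitmx).
Proof.
move=> Ux; rewrite gram_col_mx ?jacobian_orth_position//.
rewrite unitmxE det_ublock unitrM -!unitmxE gram_position_unit// andbT.
by [].
Qed.

Lemma partial_sphere_frame i x : U x ->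
  partial i S x = col_mx (partial i J x) (col_mx (partial i F x) 0).
Proof.
move=> Ux; pose e : 'rV[R]_n := delta_mx 0 i.
have dJ := smooth_on_derivable (v := e) (smooth_on_jacobian Uo sF) Ux.
have dF := smooth_on_derivable (v := e) sF Ux.
have st : smooth_on U (fun _ : 'rV[R]_n => t0) by exact: smooth_on_cst.
have dt := smooth_on_derivable (v := e) st Ux.
have sC : smooth_on U C by exact: smooth_on_col_mx.
have dC := smooth_on_derivable (v := e) sC Ux.
apply: etrans (derive_col_mx dJ dC) _.
by rewrite (derive_col_mx dF dt) derive_cst.
Qed.

Lemma sphere_shapeP x : U x -> gram ('J F x) \in unitmx ->
  shape_operators_commute S x <->
  forall v w, sphere_normal ('J F x) (F x) t0 v ->
    sphere_normal ('J F x) (F x) t0 w ->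
    hcommute (invmx (gram ('J F x))) (second_form (fun j => partial j J x) v)
      (second_form (fun j => partial j J x) w).
Proof.
move=> Ux uJ; have Dsym j k := row_partial_jacobian_comm j k Ux.
have P v w := hcommute_second_formP Dsym v w (trmx_invmx_gram ('J F x)).
have E v w i j : sphere_normal ('J F x) (F x) t0 v ->
  sphere_normal ('J F x) (F x) t0 w ->
    v *m (partial j S x)^L *m invmx (gram (S x)) *m (partial i S x *m w^L) =
    v *m (partial j J x)^L *m invmx (gram ('J F x)) *m (partial i J x *m w^L).
  move=> [Jv _ _] [Jw _ _].
  have pF (u : 'rV[R]_(2 * n)) k : 'J F x *m u^L = 0 ->
    col_mx (partial k F x) (0 : 'rV_(2 * n)) *m u^L = 0.
    move=> /orthogonal_rowsP/(_ k) Ju;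
      rewrite mul_col_mx mul0mx lorentz_scalar_mx.
    by have <- := row_jacobian sF k Ux; rewrite Ju raddf0 col_mx0.
  have -> := partial_sphere_frame i Ux; have -> := partial_sphere_frame j Ux.
  have gS : gram (S x) = block_mx (gram ('J F x)) 0 0 (gram (C x)).
    exact: gram_col_mx (jacobian_orth_position Ux).
  have uS : gram (S x) \in unitmx by rewrite sphere_frame_unit.
  rewrite gS invmx_block_diag -?gS//.
  rewrite tr_col_mx mul_mx_row mul_mx_row (lorentz_orthC (pF _ _ Jv)).
  rewrite mul_col_mx (pF _ _ Jw) mul_row_block !mulmx0 mul0mx !addr0.
  by rewrite mul_row_col mulmx0 addr0.
split=> [H v w nv nw|H v w].
  apply/P => i j; apply: etrans (esym (E v w i j nv nw)) _.
  by apply: etrans (E v w j i nv nw); apply: H; apply/sphere_frame_orth.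
move=> /sphere_frame_orth nv /sphere_frame_orth nw i j.
apply: etrans (E v w i j nv nw) _; apply: etrans (esym (E v w j i nv nw)).
exact: (P v w).2 (H v w nv nw) i j.
Qed.

End TangentFrame.

(** * Null vectors and null immersions *)

Section NullVectors.
Context (R : realType) (n : nat).

Lemma lorentz_sumE (m : 'I_(2 * n)) (x y : 'rV[R]_(2 * n)) : m.+1 = (2 * n)%N ->
  lorentz x y = \sum_(i | i != m) x 0 i * y 0 i - x 0 m * y 0 m.
Proof.
move=> mE; rewrite /lorentz mul_mx_diag mxE (bigD1 m)//= addrC.
congr (_ + _); last by rewrite !mxE mE eqxx mulrN1 mulNr.
apply: eq_bigr => i im; rewrite !mxE ifN ?mulr1//.
by apply: contra im => /eqP iE; apply/eqP/val_inj; move: iE mE => /=; lia.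
Qed.

(** With a and b the last coordinates of x and t0, the sum of the squares of
    b x_i - a t0_i over the other indices equals - a^2, hence a = 0. *)
Lemma null_orth_timelike (t0 x : 'rV[R]_(2 * n)) : (0 < n)%N ->
  lorentz t0 t0 = -1 -> lorentz x x = 0 -> lorentz x t0 = 0 -> x = 0.
Proof.
move=> n0; have mlt : ((2 * n).-1 < 2 * n)%N by lia.
pose m := Ordinal mlt; have mE : m.+1 = (2 * n)%N by rewrite /=; lia.
rewrite !(lorentz_sumE _ _ mE) => tt xx xt.
set a := x 0 m in tt xx xt *; set b := t0 0 m in tt xx xt *.
have sq : \sum_(i | i != m) (b * x 0 i - a * t0 0 i) ^+ 2 =
    b ^+ 2 * \sum_(i | i != m) x 0 i * x 0 i
    - 2 * a * b * \sum_(i | i != m) x 0 i * t0 0 i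
    + a ^+ 2 * \sum_(i | i != m) t0 0 i * t0 0 i.
  rewrite !mulr_sumr -sumrB -big_split; apply: eq_bigr => i _ /=; ring.
have sq0 : 0 <= \sum_(i | i != m) (b * x 0 i - a * t0 0 i) ^+ 2.
  by apply: sumr_ge0 => i _; exact: sqr_ge0.
have a0 : a = 0.
  move: sq0; rewrite sq.
  move/eqP: xx; rewrite subr_eq0 => /eqP ->.
  move/eqP: xt; rewrite subr_eq0 => /eqP ->.
  move/eqP: tt; rewrite subr_eq => /eqP ->.
  move=> H; apply/eqP; rewrite -sqrf_eq0 eq_le sqr_ge0 andbT.
  by rewrite -oppr_ge0; apply: le_trans H _; rewrite le_eqVlt; apply/orP; left;
    apply/eqP; ring.
have x0 : \sum_(i | i != m) x 0 i ^+ 2 = 0.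
  by move: xx; rewrite a0 mul0r subr0.
apply/rowP => i; rewrite mxE.
have [->|im] := eqVneq i m; first exact: a0.
apply/eqP; rewrite -sqrf_eq0; apply/eqP.
by apply: (psumr_eq0P _ x0) => // j _; exact: sqr_ge0.
Qed.

(** When there are at least as many rows as the dimension, only the zero vector
    is orthogonal to all of them. *)
Lemma nondegenerate_orth k (B : 'M[R]_(k, 2 * n)) v : (2 * n <= k)%N ->
  gram B \in unitmx -> B *m v^L = 0 -> v = 0 :> 'rV[R]_(2 * n).
Proof.
move=> nk uB Bv.
have : row_full B.
  rewrite -col_leq_rank (leq_trans nk)// -{1}(mxrank_unit uB).
  by rewrite gramE mxrankM_maxl.
move=> /row_fullP[B' B'B].
have : v^L = 0 by rewrite -[v^L]mul1mx -B'B -mulmxA Bv mulmx0.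
move=> /(congr1 (mulmx (lorentz_mx R n)));
  rewrite mulmxA lorentz_mxK mul1mx mulmx0.
by move=> /(congr1 trmx); rewrite trmxK trmx0.
Qed.

End NullVectors.

Section RiemannLocal.
Context (R : realType) (n : nat) (U : set 'rV[R]_n).
Hypothesis Uo : open U.

Lemma christoffel_congr (g g' : 'rV[R]_n -> 'M[R]_n) k i j x : U x ->
  (forall y, U y -> g y = g' y) -> christoffel g k i j x =
    christoffel g' k i j x.
Proof.
move=> Ux gg; rewrite /christoffel gg//; congr (_ * _); apply: eq_bigr => l _.
have E a b c : partial a (fun y => g y b c) x = partial a (fun y => g' y b c) x.
  by apply: derive_congr Uo Ux _ => y Uy; rewrite gg.
by rewrite !E.
Qed.

(** The curvature at x only depends on the metric near x. *)
Lemma riemann_congr (g g' : 'rV[R]_n -> 'M[R]_n) l k i j x : U x ->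
  (forall y, U y -> g y = g' y) -> riemann g l k i j x = riemann g' l k i j x.
Proof.
move=> Ux gg.
have C a b c y : U y -> christoffel g a b c y = christoffel g' a b c y.
  by move=> Uy; exact: christoffel_congr.
have D d a b c : partial d (christoffel g a b c) x =
  partial d (christoffel g' a b c) x.
  by apply: derive_congr Uo Ux _ => y Uy; exact: C.
rewrite /riemann (D i l j k) (D j l i k); congr (_ + _).
by apply: eq_bigr => m _; rewrite (C l i m x Ux) (C m j k x Ux) (C l j m x Ux)
  (C m i k x Ux).
Qed.

End RiemannLocal.

Section NullMaps.
Context (R : realType) (n : nat) (U : set 'rV[R]_n).
Variable F : 'rV[R]_n -> 'rV[R]_(2 * n).
Hypotheses (Uo : open U) (sF : smooth_on U F).
Hypothesis F_null : forall x, U x -> lorentz (F x) (F x) = 0.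

Lemma partial_null i x : U x -> lorentz (partial i F x) (F x) = 0.
Proof.
move=> Ux.
have H : partial i (fun y => lorentz (F y) (F y)) x = 0.
  rewrite -[RHS](partial_cst (0 : R) i x).
  by apply: derive_congr Uo Ux _ => y Uy; exact: F_null.
move: H; rewrite (partial_lorentz_form Uo i Ux sF sF) (lorentzC (F x)) => H.
lra.
Qed.

Lemma partial2_null i j x : U x ->
  lorentz (partial i (partial j F) x) (F x) =
    - lorentz (partial j F x) (partial i F x).
Proof.
move=> Ux.
have H : partial i (fun y => lorentz (partial j F y) (F y)) x = 0.
  rewrite -[RHS](partial_cst (0 : R) i x).
  by apply: derive_congr Uo Ux _ => y Uy; exact: partial_null.
move: H; rewrite (partial_lorentz_form Uo i Ux (smooth_on_partial j sF) sF) =>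
  /eqP.
by rewrite addr_eq0 => /eqP.
Qed.

Lemma null_jacobian_orth x : U x -> 'J F x *m (F x)^L = 0.
Proof.
move=> Ux; apply/orthogonal_rowsP => i; have -> := row_jacobian sF i Ux.
exact: partial_null.
Qed.

Lemma second_form_null x : U x ->
  second_form (fun j => partial j (fun y => 'J F y) x) (F x) = - gram ('J F x).
Proof.
move=> Ux; apply/matrixP => i j; rewrite [RHS]mxE gram_entry mxE.
have -> := row_partial_jacobian Uo sF i j Ux.
have -> := row_jacobian sF i Ux; have -> := row_jacobian sF j Ux.
by apply: etrans (partial2_null i j Ux) _; rewrite lorentzC.
Qed.

(** At a zero of F the second derivatives are orthogonal to F = 0, hence the
    induced metric vanishes. *)
Lemma null_immersion_neq0 x : (0 < n)%N -> U x -> gram ('J F x) \in unitmx ->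
  F x != 0.
Proof.
move=> n0 Ux uJ; apply/eqP => F0.
have g0 : gram ('J F x) = 0.
  apply: oppr_inj; rewrite -(second_form_null Ux) F0 oppr0.
  by apply/matrixP => i j; rewrite !mxE -(scale0r (0 : 'rV[R]_(2 * n)))
    lorentzZr mul0r.
have := mulmxV uJ; rewrite g0 mul0mx => /matrixP/(_ (Ordinal n0) (Ordinal n0)).
by rewrite !mxE eqxx => /eqP; rewrite eq_sym oner_eq0.
Qed.

End NullMaps.

(** * Normal bundles of a spherical map and of its lift *)

Lemma hcommute_conformal (R : realType) n (G G' M M' N N' : 'M[R]_n) (l : R) :
  l != 0 -> G \in unitmx -> G' = l ^+ 2 *: G -> M' = l *: M -> N' = l *: N ->
  hcommute (invmx G') M' N' <-> hcommute (invmx G) M N.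
Proof.
move=> l0 uG -> -> ->; have l2 : l ^+ 2 != 0 by rewrite expf_neq0.
rewrite invmxZ ?unitmxZ ?unitfE// /hcommute.
rewrite -!(scalemxAl, scalemxAr) !scalerA.
have -> : l * (l / l ^+ 2) = 1 by field.
by rewrite !scale1r.
Qed.

Section ConformalFlatness.
Context (R : realType) (n : nat) (U : set 'rV[R]_n).
Variables (t0 : 'rV[R]_(2 * n)) (phi : 'rV[R]_n -> 'rV[R]_(2 * n)).
Variable lam : 'rV[R]_n -> R.
Hypotheses (Uo : open U) (sphi : smooth_on U phi) (slam : smooth_on U lam).
Hypothesis lam0 : forall x, U x -> lam x != 0.
Hypothesis t0t0 : lorentz t0 t0 = -1.
Hypothesis phi_sphere : forall x, U x -> unit_sphere t0 (phi x).
Local Notation Phi := (fun y => lam y *: (phi y + t0)).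
Local Notation S := (fun y => col_mx ('J phi y) (col_mx (phi y) t0)).

Lemma gram_lift_unit x : U x ->
  (gram ('J Phi x) \in unitmx) = (gram ('J phi x) \in unitmx).
Proof.
move=> Ux; have l2 : lam x ^+ 2 \is a GRing.unit by rewrite unitfE expf_neq0//
  lam0.
apply: etrans (unitmxZ _ l2).
by have /(congr1 (fun M : 'M[R]_n => M \in unitmx)) :=
  gram_lift Uo sphi slam t0t0 phi_sphere Ux.
Qed.

Lemma hcommute_lift x v w : U x -> gram ('J phi x) \in unitmx ->
  sphere_normal ('J phi x) (phi x) t0 v ->
    sphere_normal ('J phi x) (phi x) t0 w ->
  hcommute (invmx (gram ('J Phi x)))
    (second_form (fun j => partial j (fun y => 'J Phi y) x) v)
    (second_form (fun j => partial j (fun y => 'J Phi y) x) w) <->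
  hcommute (invmx (gram ('J phi x)))
    (second_form (fun j => partial j (fun y => 'J phi y) x) v)
    (second_form (fun j => partial j (fun y => 'J phi y) x) w).
Proof.
move=> Ux uJ nv nw.
exact: (hcommute_conformal (lam0 Ux) uJ
  (gram_lift Uo sphi slam t0t0 phi_sphere Ux)
  (second_form_lift Uo sphi slam Ux nv) (second_form_lift Uo sphi slam Ux nw)).
Qed.

(** If phi has flat normal bundle in the sphere and its lift has flat metric,
    then the normal bundle of the lift is flat. *)
Lemma lift_normal_flat : (forall x, U x -> gram ('J Phi x) \in unitmx) ->
  (forall x, U x -> forall l k i j,
    riemann (fun y => gram ('J Phi y)) l k i j x = 0) ->
  (forall x, U x -> shape_operators_commute S x) ->
  forall x, U x -> shape_operators_commute (fun y => 'J Phi y) x.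
Proof.
move=> uPhi flat flatS x Ux.
have sPhi : smooth_on U Phi := smooth_on_lift t0 Uo sphi slam.
have PhiN y : U y -> lorentz (Phi y) (Phi y) = 0.
  by move=> Uy; exact (lorentz_lift lam t0t0 phi_sphere Uy).
have uphi : gram ('J phi x) \in unitmx by rewrite -gram_lift_unit ?uPhi.
apply/(tangent_shapeP Uo sPhi Ux) => v w Jv Jw.
have nl u := sphere_normal_lift t0 Uo sphi slam lam0 u Ux.
have Dsym j k := row_partial_jacobian_comm Uo sPhi j k Ux.
have JP := null_jacobian_orth Uo sPhi PhiN Ux.
have II := second_form_null Uo sPhi PhiN Ux.
have t0P : lorentz t0 (lam x *: (phi x + t0)) != 0.
  have [pt _] := phi_sphere Ux.
  by rewrite lorentzC lorentzZl lorentzDl pt t0t0 add0r mulrN1 oppr_eq0 lam0.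
have gauss i j k :
    row k (partial j (fun y => 'J Phi y) x) *m normal_mx ('J Phi x) *m
      (partial i (fun y => 'J Phi y) x)^L =
    row k (partial i (fun y => 'J Phi y) x) *m normal_mx ('J Phi x) *m
      (partial j (fun y => 'J Phi y) x)^L.
  have := gauss_equation Uo sPhi uPhi Ux (flat x Ux) i j k.
  have <- := row_partial_jacobian Uo sPhi j k Ux.
  by have <- := row_partial_jacobian Uo sPhi i k Ux.
have flat_sphere v' w' (nv : sphere_normal ('J Phi x) (lam x *: (phi x + t0)) t0
  v')
    (nw : sphere_normal ('J Phi x) (lam x *: (phi x + t0)) t0 w') :=
  (hcommute_lift Ux uphi ((nl v').1 nv) ((nl w').1 nw)).2
    ((sphere_shapeP Uo sphi t0t0 phi_sphere Ux uphi).1 (flatS x Ux)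
       v' w' ((nl v').1 nv) ((nl w').1 nw)).
have dim : (2 < n)%N \/ forall u,
    sphere_normal ('J Phi x) (lam x *: (phi x + t0)) t0 u -> u = 0.
  (* For n <= 2 the frame consists of n + 2 >= 2 n vectors. *)
  have [n2|n2] := leqP 3 n; [by left|right] => u /nl/sphere_frame_orth Su.
  apply: nondegenerate_orth Su; first by lia.
  by have -> := sphere_frame_unit Uo sphi t0t0 phi_sphere Ux.
exact (second_form_hcommute Dsym (uPhi x Ux) JP (PhiN x Ux) II t0P gauss
  flat_sphere dim Jv Jw).
Qed.

(** Every vector normal to phi in the sphere is normal to the lift, so the
    flatness of the metric plays no role in this direction. *)
Lemma sphere_normal_flat : (forall x, U x -> gram ('J Phi x) \in unitmx) ->
  (forall x, U x -> shape_operators_commute (fun y => 'J Phi y) x) ->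
  forall x, U x -> shape_operators_commute S x.
Proof.
move=> uPhi flatP x Ux.
have sPhi : smooth_on U Phi := smooth_on_lift t0 Uo sphi slam.
have uphi : gram ('J phi x) \in unitmx by rewrite -gram_lift_unit ?uPhi.
apply/(sphere_shapeP Uo sphi t0t0 phi_sphere Ux uphi) => v w nv nw.
have nl u := sphere_normal_lift t0 Uo sphi slam lam0 u Ux.
have [Jv _ _] := (nl v).2 nv; have [Jw _ _] := (nl w).2 nw.
have H := (tangent_shapeP Uo sPhi Ux).1 (flatP x Ux) v w Jv Jw.
exact ((hcommute_lift Ux uphi nv nw).1 H).
Qed.

End ConformalFlatness.

(** * Globalization to the manifold *)

Lemma open_chart_img (R : realType) n (M : topologicalType) (c : chart R n M) :
  open (chart_img c).
Proof. exact: chart_img_open. Qed.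
Arguments open_chart_img {R n M} c.

Lemma flat_complementP (R : realType) n (M : smoothManifold R n) k
    (B : chart R n M -> 'rV[R]_n -> 'M[R]_(k, 2 * n)) :
  (forall c, manifold_atlas c -> smooth_on (chart_img c) (B c)) ->
  (forall c, manifold_atlas c -> forall x, chart_img c x ->
    gram (B c x) \in unitmx) ->
  flat_complement B <->
  (forall c, manifold_atlas c -> forall x, chart_img c x ->
     shape_operators_commute (B c) x).
Proof.
move=> sB uB; split=> H c ac.
  have [+ _] := flat_complement_chartP (open_chart_img c) (sB c ac) (uB c ac).
  by apply; exact: H.
have [_ +] := flat_complement_chartP (open_chart_img c) (sB c ac) (uB c ac).
by apply; exact: H.
Qed.

Lemma jacobian_injective (R : realType) n (F : 'rV[R]_n -> 'rV[R]_(2 * n)) x :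
  differentiable F x -> gram ('J F x) \in unitmx -> injective ('d F x).
Proof.
move=> dF uJ a b dab; apply/eqP; rewrite -subr_eq0; apply/eqP.
have aJ : (a - b) *m 'J F x = 0.
  rewrite -deriveEjacobian// deriveE//.
  by rewrite linearB /= dab subrr.
rewrite -[a - b](mulmxK uJ) gramE [_ *m ('J F x *m _)]mulmxA aJ.
by rewrite !mul0mx.
Qed.

Section ConformalPair.
Context (R : realType) (n : nat) (M : smoothManifold R n).
Variables (t0 : 'rV[R]_(2 * n)) (f F : M -> 'rV[R]_(2 * n)) (lam : M -> R).
Hypothesis t0t0 : lorentz t0 t0 = -1.
Hypothesis FE : F = fun p => lam p *: (f p + t0).
Hypothesis lam0 : forall p, lam p != 0.
Hypotheses (f_smooth : smooth_map f) (lam_smooth : smooth_map lam).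
Hypothesis f_sphere : forall p, unit_sphere t0 (f p).

Lemma pair_lift : Defs.lift t0 f F.
Proof.
split=> [c ac|p|p].
- rewrite FE; exact (smooth_on_lift t0 (open_chart_img c) (f_smooth ac)
  (lam_smooth ac)).
- have [ft ff] := f_sphere p; rewrite /light_cone /= FE.
  by rewrite lorentzZl lorentzZr lorentzDl !lorentzDr ff ft lorentzC ft t0t0;
    ring.
- by exists (lam p)^-1; rewrite FE scalerA mulVf// scale1r.
Qed.

Lemma pair_induced_metric c x : manifold_atlas c -> chart_img c x ->
  induced_metric F c x = lam (chart_inv c x) ^+ 2 *: induced_metric f c x.
Proof.
move=> ac Ux; rewrite FE.
exact (gram_lift (open_chart_img c) (f_smooth ac) (lam_smooth ac) t0t0
  (fun y _ => f_sphere (chart_inv c y)) Ux).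
Qed.

(** The metric of F is the conformal multiple of the metric of f by e^(2u). *)
Lemma pair_flat_metric (u : M -> R) :
  (forall p, expR (2 * u p) = lam p ^+ 2) ->
  flat_metric (fun c x => expR (2 * u (chart_inv c x)) *: induced_metric f c x)
    <->
  flat_metric (induced_metric F).
Proof.
move=> uE.
have E c x : manifold_atlas c -> chart_img c x ->
    expR (2 * u (chart_inv c x)) *: induced_metric f c x = induced_metric F c x.
  by move=> ac Ux; rewrite uE -pair_induced_metric.
split=> H c ac x Ux; have [uH RH] := H c ac x Ux; split.
- by rewrite -E.
- move=> l k i j; rewrite -(RH l k i j); symmetry.
  by apply: (riemann_congr (open_chart_img c)) => // y Uy; exact: E.
- by rewrite E.
- move=> l k i j; rewrite -(RH l k i j).
  by apply: (riemann_congr (open_chart_img c)) => // y Uy; exact: E.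
Qed.

Hypothesis F_flat : flat_metric (induced_metric F).

Lemma pair_unit_F c x : manifold_atlas c -> chart_img c x ->
  gram ('J (F \o chart_inv c) x) \in unitmx.
Proof. by move=> ac Ux; have [] := F_flat ac Ux. Qed.

Lemma pair_unit_f c x : manifold_atlas c -> chart_img c x ->
  gram ('J (f \o chart_inv c) x) \in unitmx.
Proof.
move=> ac Ux; have uF := pair_unit_F ac Ux; rewrite FE in uF.
have E := gram_lift_unit (open_chart_img c) (f_smooth ac) (lam_smooth ac)
  (fun y _ => lam0 (chart_inv c y)) t0t0 (fun y _ => f_sphere (chart_inv c y))
    Ux.
exact (etrans (esym E) uF).
Qed.

(** The normal bundle of f in the sphere is flat if and only if the one of F
    is. *)
Lemma pair_normal_flat : flat_sphere_normal_bundle t0 f <->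
  flat_normal_bundle F.
Proof.
have Uo (c : chart R n M) := open_chart_img c.
have sphf (c : chart R n M) y (_ : chart_img c y) := f_sphere (chart_inv c y).
have sF c (ac : manifold_atlas c) : smooth_on (chart_img c) (F \o chart_inv c).
  by have [+ _ _] := pair_lift; exact.
have HF : flat_normal_bundle F <-> _ := flat_complementP
  (fun c ac => smooth_on_jacobian (Uo c) (sF c ac))
  (fun c ac x Ux => pair_unit_F ac Ux).
have Hf : flat_sphere_normal_bundle t0 f <-> _ := flat_complementP
  (fun c ac => smooth_on_sphere_frame (Uo c) (f_smooth ac) t0)
  (fun c ac x Ux => etrans (sphere_frame_unit (Uo c) (f_smooth ac) t0t0 (sphf c)
    Ux)
     (pair_unit_f ac Ux)).
have uF c x (ac : manifold_atlas c) (Ux : chart_img c x) := pair_unit_F ac Ux.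
have RF c x (ac : manifold_atlas c) (Ux : chart_img c x) l k i j :
  riemann (fun y => gram ('J (F \o chart_inv c) y)) l k i j x = 0.
  by have [_] := F_flat ac Ux; exact.
rewrite FE in uF RF HF *.
split=> [/Hf H|/HF H].
  apply/HF => c ac x Ux.
  exact (lift_normal_flat (Uo c) (f_smooth ac) (lam_smooth ac)
    (fun y _ => lam0 (chart_inv c y)) t0t0 (sphf c) (uF c ^~ ac) (RF c ^~ ac)
      (H c ac) Ux).
apply/Hf => c ac x Ux.
exact (sphere_normal_flat (Uo c) (f_smooth ac) (lam_smooth ac)
  (fun y _ => lam0 (chart_inv c y)) t0t0 (sphf c) (uF c ^~ ac) (H c ac) Ux).
Qed.

End ConformalPair.

Theorem theorem2p4 (R : realType) (n : nat) (hn : (0 < n)%N)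
    (t0 : 'rV[R]_(2 * n)) (ht0 : lorentz t0 t0 = -1)
    (M : smoothManifold R n) :
  (forall f : M -> 'rV[R]_(2 * n),
     sphere_immersion t0 f ->
     conformally_flat f ->
     flat_sphere_normal_bundle t0 f ->
     exists F : M -> 'rV[R]_(2 * n),
       flat_lift t0 f F /\ flat_normal_bundle F)
  /\
  (forall F : M -> 'rV[R]_(2 * n),
     light_cone_immersion F ->
     flat_metric (induced_metric F) ->
     definite_metric (induced_metric F) ->
     flat_normal_bundle F ->
     exists f : M -> 'rV[R]_(2 * n),
       [/\ sphere_immersion t0 f, conformally_flat f,
           flat_sphere_normal_bundle t0 f & flat_lift t0 f F]).
Proof.
split.
- move=> f [f_sphere [f_smooth _]] [u u_smooth u_flat] f_normal.
  pose lam p := expR (u p); pose F p := lam p *: (f p + t0).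
  have lam0 p : lam p != 0 by rewrite gt_eqF// expR_gt0.
  have lam_smooth : smooth_map lam.
    by move=> c ac k; exact (Ck_on_expR (open_chart_img c) (u_smooth c ac k)).
  have uE p : expR (2 * u p) = lam p ^+ 2 by rewrite expRM_natl.
  have FE : F = fun p => lam p *: (f p + t0) by [].
  have F_flat := (pair_flat_metric ht0 FE f_smooth lam_smooth f_sphere uE).1
    u_flat.
  exists F; split; last first.
    exact ((pair_normal_flat ht0 FE lam0 f_smooth lam_smooth f_sphere F_flat).1
      f_normal).
  by split=> //; exact (pair_lift ht0 FE lam0 f_smooth lam_smooth f_sphere).
- move=> F [F_null [F_smooth _]] F_flat _ F_normal.
  have unitF c x : manifold_atlas c -> chart_img c x ->
      gram ('J (F \o chart_inv c) x) \in unitmx.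
    by move=> ac Ux; have [] := F_flat c ac x Ux.
  have F0 p : F p != 0.
    have [c ac cp] := manifold_cover p.
    have Ux : chart_img c (chart_map c p) by exists p.
    have N y : chart_img c y -> lorentz ((F \o chart_inv c) y)
      ((F \o chart_inv c) y) = 0.
      by move=> _; exact: F_null.
    have := null_immersion_neq0 (open_chart_img c) (F_smooth c ac) N hn Ux
      (unitF c _ ac Ux).
    by rewrite /= chart_mapK.
  pose lam p := - lorentz (F p) t0.
  have lam0 p : lam p != 0.
    rewrite oppr_eq0; apply/eqP => Ft.
    by have /eqP := F0 p; apply; exact: null_orth_timelike hn ht0 (F_null p) Ft.
  have lam_smooth : smooth_map lam.
    move=> c ac; have Uo := open_chart_img c.
    have st : smooth_on (chart_img c) (fun _ : 'rV[R]_n => - t0) by exact: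
      smooth_on_cst.
    apply: smooth_on_congr Uo _ (smooth_on_lorentz Uo (F_smooth c ac) st) =>
      x _.
    exact: lorentzNr.
  pose f p := (lam p)^-1 *: F p - t0.
  have FE : F = fun p => lam p *: (f p + t0).
    by apply/funext => p; rewrite subrK scalerA divff// scale1r.
  have f_smooth : smooth_map f.
    move=> c ac; have Uo := open_chart_img c.
    apply: (smooth_onD Uo); last exact: smooth_on_cst.
    apply: (smooth_onZ Uo); last exact: F_smooth.
    by apply: (smooth_onV Uo); [move=> x _; exact: lam0|exact: lam_smooth].
  have f_sphere p : unit_sphere t0 (f p).
    have Ft : lorentz (F p) t0 = - lam p by rewrite opprK.
    have FF : lorentz (F p) (F p) = 0 := F_null p.
    split.
      by rewrite lorentzDl lorentzZl lorentzNl ht0 Ft mulrN mulVf// opprK addNr.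
    rewrite !lorentzDl !lorentzDr !(lorentzZl, lorentzZr, lorentzNl, lorentzNr).
    rewrite FF (lorentzC t0) Ft ht0; have l0 := lam0 p; by field.
  have f_flat : conformally_flat f.
    pose u p := ln (lam p ^+ 2) / 2.
    have uE p : expR (2 * u p) = lam p ^+ 2.
      rewrite /u mulrC divfK// lnK// posrE.
      by rewrite lt_neqAle sqr_ge0 andbT eq_sym expf_neq0 ?lam0.
    exists u; last first.
      exact ((pair_flat_metric ht0 FE f_smooth lam_smooth f_sphere uE).2
        F_flat).
    move=> c ac k; have Uo := open_chart_img c.
    apply: (Ck_onM Uo); last exact: Ck_on_cst.
    apply: (Ck_on_ln Uo) => [x _|].
      by rewrite /= lt_neqAle sqr_ge0 andbT eq_sym expf_neq0 ?lam0.
    exact: (Ck_onM Uo (lam_smooth c ac k) (lam_smooth c ac k)).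
  exists f; split=> //.
  + split=> //; split=> // c ac x Ux.
    apply: jacobian_injective.
      exact: smooth_on_differentiable (f_smooth c ac) Ux.
    exact: (pair_unit_f ht0 FE lam0 f_smooth lam_smooth f_sphere F_flat ac Ux).
  + exact: (pair_normal_flat ht0 FE lam0 f_smooth lam_smooth f_sphere F_flat).2
    F_normal.
  + by split=> //; exact (pair_lift ht0 FE lam0 f_smooth lam_smooth f_sphere).
Qed.
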